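(* For each $\epsilon>0$, there is a $(4+\epsilon)$-approximation algorithm for the scheduling problem $1||\sum f_j$.
   Context: Problem $1||\sum f_j$: a finite set of $n$ jobs, each job $j$ with a positive integer processing time $p_j$ and a nondecreasing cost function $f_j$ from the positive integers to the nonnegative integers; a schedule processes the jobs one at a time, without preemption, on a single machine; $C_j$ is the completion time of job $j$; the objective is to minimize $\sum_j f_j(C_j)$. A $(4+\epsilon)$-approximation algorithm is an algorithm running in time polynomial in the input size (here: polynomial in $n$, $\log P$ and $\log W$, where $P=\max_jp_j$ and $W=\max_{j,t}(f_j(t)-f_j(t-1))$, with the cost functions accessible through evaluation) that always outputs a schedule of cost at most $(4+\epsilon)$ times the optimal cost. *)

(* Defs.v *)
From mathcomp Require Import all_boot all_order all_algebra.
From mathcomp Require Import boolp reals.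

Set Implicit Arguments.
Unset Strict Implicit.
Unset Printing Implicit Defensive.

Import Order.TTheory GRing.Theory Num.Theory.

(** * The problem 1||sum f_j *)

(** A function from the positive integers to the nonnegative integers is
    represented by its extension to [nat] with value 0 at 0. This is also the
    convention that gives [f_j(1) - f_j(0)] a meaning in [max_increment]. *)
Record instance := Instance {
  njobs : nat;
  ptime : 'I_njobs -> nat;
  fcost : 'I_njobs -> nat -> nat;
  ptime_gt0 : forall j, 0 < ptime j;
  fcost_0 : forall j, fcost j 0 = 0;
  fcost_nondecreasing : forall j, {homo fcost j : s t / s <= t}
}.

Section Schedules.
Variable I : instance.
Implicit Types S : 'I_(njobs I) -> nat.

(** A schedule is given by the start times; idle time is allowed. *)
Definition completion S (j : 'I_(njobs I)) : nat := S j + ptime j.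

Definition feasible S : Prop :=
  forall i j, i != j -> completion S i <= S j \/ completion S j <= S i.

Definition sched_cost S : nat := \sum_(j < njobs I) fcost j (completion S j).

Definition attainable_cost : pred nat :=
  fun v => `[< exists2 S, feasible S & sched_cost S = v >].

Lemma attainable_cost_ex : exists v, attainable_cost v.
Proof.
pose S (j : 'I_(njobs I)) := \sum_(i < njobs I | i < j) ptime i.
have leS (i j : 'I_(njobs I)) : i < j -> completion S i <= S j.
  move=> ij; rewrite /completion /S [leqRHS](bigD1 i) //= addnC leq_add2l.
  rewrite big_mkcond [leqRHS]big_mkcond leq_sum // => k _.
  case: ifP => // ki; rewrite (ltn_trans ki ij) /=.
  by case: eqP => //= ki'; rewrite ki' ltnn in ki.
exists (sched_cost S); apply/asboolP; exists S => // i j neq_ij.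
by case: (ltngtP i j) => [/leS|/leS|/val_inj/eqP]; [left | right | rewrite (negPf neq_ij)].
Qed.

Definition opt_cost : nat := ex_minn attainable_cost_ex.

Definition horizon : nat := \sum_(j < njobs I) ptime j.
Definition max_ptime : nat := \max_(j < njobs I) ptime j.
(** The maximum over all [t] need not exist; no schedule without idle time
    evaluates a cost function after [horizon]. *)
Definition max_increment : nat :=
  \max_(j < njobs I) \max_(1 <= t < horizon.+1) (fcost j t - fcost j t.-1).

End Schedules.

(** Length of the binary representation, with [bits 0 = 1]. *)
Definition bits (n : nat) : nat := (trunc_log 2 n).+1.

Definition input_size (I : instance) : nat :=
  njobs I + bits (max_ptime I) + bits (max_increment I).

(** * Machine model

    A deterministic structured random access machine with an oracle, under the
    logarithmic cost criterion. The memory consists of arrays of natural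
    numbers of unbounded size; a scalar variable is cell 0 of an array. *)

Definition store := nat -> nat -> nat.

Definition upd (s : store) (a i v : nat) : store :=
  fun b k => if (b == a) && (k == i) then v else s b k.

Inductive binop := OpAdd | OpSub | OpMul | OpDiv | OpMod | OpLeq | OpEq.

Inductive expr :=
| Const of nat
| Cell of nat & expr
| Op of binop & expr & expr
| Query of expr & expr.

Inductive cmd :=
| Skip
| Assign of nat & expr & expr (* [Assign a i e] is  a[i] := e *)
| Seq of cmd & cmd
| If of expr & cmd & cmd
| While of expr & cmd.

Definition eval_op (o : binop) : nat -> nat -> nat :=
  match o with
  | OpAdd => addn
  | OpSub => subn
  | OpMul => muln
  | OpDiv => divn
  | OpMod => modn
  | OpLeq => fun x y => x <= y
  | OpEq => fun x y => x == y
  end.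

Section Semantics.
Variable oracle : nat -> nat -> nat.

Fixpoint eval (s : store) (e : expr) : nat :=
  match e with
  | Const n => n
  | Cell a i => s a (eval s i)
  | Op o e1 e2 => eval_op o (eval s e1) (eval s e2)
  | Query e1 e2 => oracle (eval s e1) (eval s e2)
  end.

(** Each node is charged the length of its value. As the operands (addresses
    and oracle arguments included) are nodes themselves, an operation is charged
    for its operands and for its result. *)
Fixpoint eval_time (s : store) (e : expr) : nat :=
  bits (eval s e) +
  match e with
  | Const _ => 0
  | Cell _ i => eval_time s i
  | Op _ e1 e2 | Query e1 e2 => eval_time s e1 + eval_time s e2
  end.

(** [exec c s t s']: started in [s], [c] halts in [s'] after time [t]. *)
Inductive exec : cmd -> store -> nat -> store -> Prop :=
| ExecSkip s : exec Skip s 1 s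
| ExecAssign a i e s :
    exec (Assign a i e) s (eval_time s i + eval_time s e)
         (upd s a (eval s i) (eval s e))
| ExecSeq c1 c2 s1 s2 s3 t1 t2 :
    exec c1 s1 t1 s2 -> exec c2 s2 t2 s3 -> exec (Seq c1 c2) s1 (t1 + t2) s3
| ExecIfTrue e c1 c2 s s' t :
    eval s e != 0 -> exec c1 s t s' ->
    exec (If e c1 c2) s (eval_time s e + t) s'
| ExecIfFalse e c1 c2 s s' t :
    eval s e = 0 -> exec c2 s t s' ->
    exec (If e c1 c2) s (eval_time s e + t) s'
| ExecWhileTrue e c s1 s2 s3 t1 t2 :
    eval s1 e != 0 -> exec c s1 t1 s2 -> exec (While e c) s2 t2 s3 ->
    exec (While e c) s1 (eval_time s1 e + t1 + t2) s3
| ExecWhileFalse e c s :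
    eval s e = 0 -> exec (While e c) s (eval_time s e) s.

Lemma exec_deterministic c s t1 s1 t2 s2 :
  exec c s t1 s1 -> exec c s t2 s2 -> t1 = t2 /\ s1 = s2.
Proof.
have neqF s' e : eval s' e != 0 -> eval s' e = 0 -> False by move=> /eqP.
move=> H; elim: H t2 s2 => {c s t1 s1}; intros;
  match goal with H : exec _ _ ?t ?s |- _ /\ _ = ?s => inversion H; subst end;
  try (by exfalso; eauto);
  repeat match goal with
    IH : (forall t s, exec ?c ?s0 t s -> _), H : exec ?c ?s0 _ _ |- _ =>
      have [? ?] := IH _ _ H; clear IH; subst
  end; by [].
Qed.

End Semantics.

(** * Approximation algorithms for 1||sum f_j *)

(** The oracle answers a query [(j, t)] with [f_j(t)]; queries about
    nonexistent jobs are answered with 0. *)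
Definition cost_oracle (I : instance) (j t : nat) : nat :=
  if insub j is Some j' then @fcost I j' t else 0.

(** Array 0 holds [n] in cell 0, array 1 holds the processing times, and all
    other cells are 0. *)
Definition init_store (I : instance) : store := fun a i =>
  match a, i with
  | 0, 0 => njobs I
  | 1, _ => if insub i is Some j then @ptime I j else 0
  | _, _ => 0
  end.

(** On halting, array 2 holds the start times. *)
Definition output (I : instance) (s : store) : 'I_(njobs I) -> nat :=
  fun j => s 2 j.
Arguments output : clear implicits.

Definition runs_within (c : cmd) (B : instance -> nat) : Prop :=
  forall I, exists t s,
    exec (cost_oracle I) c (init_store I) t s /\ t <= B I.

Definition polynomial_time (c : cmd) : Prop :=
  exists C k, runs_within c (fun I => C * input_size I ^ k).

Local Open Scope ring_scope.

Definition approximates (R : realType) (alpha : R) (c : cmd) : Prop :=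
  forall I, exists t s,
    exec (cost_oracle I) c (init_store I) t s /\
    feasible (output I s) /\
    (sched_cost (output I s))%:R <= alpha * (opt_cost I)%:R.

Definition approximation_algorithm (R : realType) (alpha : R) (c : cmd) :
    Prop :=
  polynomial_time c /\ approximates alpha c.

(* Main.v *)
(** Round the time axis: starting from [tau 0 = 0], let [tau (i+1)] be the first
    time at which some [f_j] exceeds [(1 + 1/K) f_j(tau i)]. There are only
    polynomially many such times. Give job [j] the level [x_j = i] and the weight
    [f_j(tau i)] if it completes in [[tau i, tau (i+1))]. A choice of levels comes
    from a schedule exactly when, for every [i], the jobs of level at least [i]
    have total processing time at least [D i = T - (tau i - 1)], and processing
    the jobs by increasing level loses a factor at most [1 + 1/K].

    This covering problem is approximated within 4 by local ratio. All jobs start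
    at level 0. As long as some [i] is not covered, let [t] maximise the deficit
    [d], and subtract from the weights the largest multiple of the model weight
    [min(p_j, d)] (charged to the jobs [j] below [t] that are raised to [t] or
    above) which keeps them nonnegative; a job whose residual weight vanishes at
    a level [s >= t] is raised to [s] for free. The knapsack-cover inequality says
    that every solution has model weight at least [d]. Finally the raises are
    undone in reverse order whenever the levels stay feasible. The result is
    minimal, so each job raised across [t] is indispensable at some point left or
    right of [t]; since no deficit exceeds [d], the jobs on each side have model
    weight at most [2 d], whence the ratio 4.

    All numbers are kept integral by scaling with [min(p_j, d)] instead of
    dividing, which adds [O(log T)] bits in each of the polynomially many
    iterations. *)

Require Import Defs.
From mathcomp Require Import all_boot all_order all_algebra.
From mathcomp Require Import boolp reals zify.

Set Implicit Arguments.
Unset Strict Implicit.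
Unset Printing Implicit Defensive.

Import Order.TTheory GRing.Theory Num.Theory.

(** * Running time of programs with bounded loops and numbers *)

(* A constant [c] is charged [c.+1], so that its value is at most [2 ^ esize]. *)
Fixpoint esize (e : expr) : nat :=
  match e with
  | Const c => c.+1
  | Cell _ i => (esize i).+1
  | Op _ e1 e2 | Query e1 e2 => (esize e1 + esize e2).+1
  end.

(* Running time, up to the bit length of the numbers, if no loop does more than
   [X] iterations. *)
Fixpoint cost (X : nat) (c : cmd) : nat :=
  match c with
  | Skip => 1
  | Assign _ i e => esize i ^ 2 + esize e ^ 2
  | Seq c1 c2 => cost X c1 + cost X c2
  | If e c1 c2 => esize e ^ 2 + cost X c1 + cost X c2
  | While e c => X.+1 * esize e ^ 2 + X * cost X c
  end.

Fixpoint writes (c : cmd) : seq nat :=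
  match c with
  | Skip => [::]
  | Assign a _ _ => [:: a]
  | Seq c1 c2 | If _ c1 c2 => writes c1 ++ writes c2
  | While _ c => writes c
  end.

Lemma esize_gt0 e : 0 < esize e. Proof. by case: e. Qed.

(** Only loops multiply by [X], so the nesting depth of the loops serves as the degree [d]. *)
Lemma cost_polynomial c : exists A d, forall X, cost X c <= A * X.+1 ^ d.
Proof.
have bump A d d' X : d <= d' -> A * X.+1 ^ d <= A * X.+1 ^ d'.
  by move=> dd; rewrite leq_mul // leq_pexp2l.
elim: c => [|a i e|c1 [A1 [d1 H1]] c2 [A2 [d2 H2]]|e c1 [A1 [d1 H1]] c2 [A2 [d2 H2]]|e c [A [d H]]].
- by exists 1, 0 => X; rewrite expn0.
- by exists (esize i ^ 2 + esize e ^ 2), 0 => X; rewrite expn0 muln1.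
- exists (A1 + A2), (maxn d1 d2) => X /=; rewrite mulnDl leq_add //.
    by apply: leq_trans (H1 X) _; rewrite bump ?leq_maxl.
  by apply: leq_trans (H2 X) _; rewrite bump ?leq_maxr.
- exists (esize e ^ 2 + A1 + A2), (maxn d1 d2) => X /=; rewrite !mulnDl !leq_add //.
  + by rewrite leq_pmulr // expn_gt0.
  + by apply: leq_trans (H1 X) _; rewrite bump ?leq_maxl.
  + by apply: leq_trans (H2 X) _; rewrite bump ?leq_maxr.
- exists (esize e ^ 2 + A), d.+1 => X /=; rewrite mulnDl leq_add //.
    by rewrite mulnC leq_mul // expnS leq_pmulr // expn_gt0.
  by rewrite expnS mulnCA leq_mul.
Qed.

Lemma bits_le v k : v <= 2 ^ k -> bits v <= k.+1.
Proof. by move=> /(leq_trunc_log 2); rewrite trunc_expnK. Qed.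

Lemma exec_frame o c s t s' : exec o c s t s' ->
  forall a, a \notin writes c -> s' a = s a.
Proof.
elim=> {c s t s'} //=.
- move=> b i e s a; rewrite inE => ab; apply/funext => k.
  by rewrite /upd (negPf ab).
- move=> c1 c2 s1 s2 s3 t1 t2 _ IH1 _ IH2 a; rewrite mem_cat negb_or.
  by case/andP=> a1 a2; rewrite IH2 // IH1.
- move=> e c1 c2 s s' t _ _ IH a; rewrite mem_cat negb_or.
  by case/andP=> a1 a2; rewrite IH.
- move=> e c1 c2 s s' t _ _ IH a; rewrite mem_cat negb_or.
  by case/andP=> a1 a2; rewrite IH.
- by move=> e c s1 s2 s3 t1 t2 _ _ IH1 _ IH2 a ac; rewrite IH2 // IH1.
Qed.

(** * Program logic for total correctness with bounds on time and on number size *)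

Section WeakestPrecondition.
Variables (o : nat -> nat -> nat) (L X : nat).

Definition capped (s : store) := forall a i, s a i <= 2 ^ L.

Fixpoint queries_capped (s : store) (e : expr) : Prop :=
  match e with
  | Const _ => True
  | Cell _ i => queries_capped s i
  | Op _ e1 e2 => queries_capped s e1 /\ queries_capped s e2
  | Query e1 e2 => [/\ queries_capped s e1, queries_capped s e2 &
      o (eval o s e1) (eval o s e2) <= 2 ^ L]
  end.

(** The invariant [capped] and the time bound travel inside [wp], so verifying a program only
    requires a bound on each stored value and on each iteration count. *)
Definition wp (c : cmd) (Q : store -> Prop) (s : store) : Prop :=
  capped s -> exists t s',
    [/\ exec o c s t s', t <= L.+1 * cost X c, capped s' & Q s'].

Hypothesis L_gt0 : 0 < L.

(** Intermediate values may exceed the cap. Both operands have bounds of at least 2, so every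
    operation stays below the product of these bounds and the exponents add up. *)
Lemma eval_le s e : capped s -> queries_capped s e ->
  eval o s e <= 2 ^ (L * esize e).
Proof.
move=> cs; have pos e' : 1 < 2 ^ (L * esize e').
  by rewrite -{1}(expn0 2) ltn_exp2l // muln_gt0 L_gt0 esize_gt0.
have up k : 2 ^ L <= 2 ^ (L * k.+1) by rewrite leq_exp2l // leq_pmulr.
elim: e => [c|a i IH|op e1 IH1 e2 IH2|e1 IH1 e2 IH2] /=.
- move=> _; apply: leq_trans (_ : 2 ^ c <= _); first exact/ltnW/ltn_expl.
  by rewrite leq_exp2l // (leq_trans (leqnSn c)) // leq_pmull.
- by move=> _; apply: leq_trans (cs _ _) _.
- case=> /IH1 {}IH1 /IH2 {}IH2.
  have big v : v <= 2 ^ (L * esize e1) * 2 ^ (L * esize e2) ->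
     v <= 2 ^ (L * (esize e1 + esize e2).+1).
    by move=> h; apply: leq_trans h _; rewrite -expnD -mulnDr leq_exp2l // leq_mul.
  have p1 := pos e1; have p2 := pos e2.
  apply: big; case: op => /=.
  + set A := 2 ^ _ in p1 IH1 *; set B := 2 ^ _ in p2 IH2 *; nia.
  + by apply: leq_trans (leq_subr _ _) _; apply: leq_trans IH1 _; apply: leq_pmulr; lia.
  + exact: leq_mul.
  + by apply: leq_trans (leq_div _ _) _; apply: leq_trans IH1 _; apply: leq_pmulr; lia.
  + by apply: leq_trans (leq_mod _ _) _; apply: leq_trans IH1 _; apply: leq_pmulr; lia.
  + by apply: leq_trans (leq_b1 _) _; rewrite muln_gt0; apply/andP; split; lia.
  + by apply: leq_trans (leq_b1 _) _; rewrite muln_gt0; apply/andP; split; lia.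
- by case=> _ _ h; apply: leq_trans h _.
Qed.

(** There are at most [esize e] nodes, each with a value of [O(L * esize e)] bits, whence the
    square. *)
Lemma eval_time_le s e : capped s -> queries_capped s e ->
  eval_time o s e <= L.+1 * esize e ^ 2.
Proof.
move=> cs; have node e' : queries_capped s e' -> bits (eval o s e') <= L.+1 * esize e'.
  move=> q; apply: leq_trans (bits_le (eval_le cs q)) _.
  by rewrite mulSn -add1n leq_add2r esize_gt0.
elim: e => [c|a i IH|op e1 IH1 e2 IH2|e1 IH1 e2 IH2] q; have := node _ q.
- move=> /= h; rewrite addn0; apply: leq_trans h _.
  by rewrite leq_mul // expnS leq_pmulr // expn1.
- move: q => /= /IH; set A := esize i; move: (eval_time o s i) => a1.
  by move: (bits _) => b; rewrite -!mulnn; nia.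
- move: q => /= [/IH1 + /IH2]; set A := esize e1; set B := esize e2.
  move: (eval_time o s e1) (eval_time o s e2) => a1 a2; move: (bits _) => b.
  by rewrite -!mulnn; nia.
- move: q => /= [/IH1 + /IH2 + _]; set A := esize e1; set B := esize e2.
  move: (eval_time o s e1) (eval_time o s e2) => a1 a2; move: (bits _) => b.
  by rewrite -!mulnn; nia.
Qed.

Lemma wp_skip (Q : store -> Prop) s : Q s -> wp Skip Q s.
Proof. by move=> q cs; exists 1, s; split=> //; exact: ExecSkip. Qed.

Lemma wp_assign a i e (Q : store -> Prop) s :
  queries_capped s i -> queries_capped s e -> eval o s e <= 2 ^ L ->
  Q (upd s a (eval o s i) (eval o s e)) -> wp (Assign a i e) Q s.
Proof.
move=> qi qe v q cs; exists (eval_time o s i + eval_time o s e).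
exists (upd s a (eval o s i) (eval o s e)); split=> //.
- exact: ExecAssign.
- by rewrite /= mulnDr leq_add // eval_time_le.
- by move=> b k; rewrite /upd; case: ifP.
Qed.

Lemma wp_seq c1 c2 Q s : wp c1 (wp c2 Q) s -> wp (Seq c1 c2) Q s.
Proof.
move=> h cs; have [t1 [s1 [e1 l1 cs1 h2]]] := h cs.
have [t2 [s2 [e2 l2 cs2 h3]]] := h2 cs1.
exists (t1 + t2), s2; split=> //; first exact: ExecSeq e1 e2.
by rewrite /= mulnDr leq_add.
Qed.

Lemma wp_if e c1 c2 Q s : queries_capped s e ->
  (eval o s e != 0 -> wp c1 Q s) -> (eval o s e = 0 -> wp c2 Q s) ->
  wp (If e c1 c2) Q s.
Proof.
move=> q h1 h2 cs; have te := eval_time_le cs q.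
case: (altP (eval o s e =P 0)) => [z|nz].
  have [t [s' [e' l cs' h3]]] := h2 z cs.
  exists (eval_time o s e + t), s'; split=> //; first exact: ExecIfFalse.
  by rewrite /= !mulnDr -addnA leq_add // (leq_trans l) ?leq_addl.
have [t [s' [e' l cs' h3]]] := h1 nz cs.
exists (eval_time o s e + t), s'; split=> //; first exact: ExecIfTrue.
by rewrite /= !mulnDr -addnA leq_add // (leq_trans l) ?leq_addr.
Qed.

(** Consequence and frame rule in one: arrays that [c] does not write keep their contents. *)
Lemma wp_conseq c (Q Q' : store -> Prop) s :
  wp c Q s ->
  (forall s', (forall a, a \notin writes c -> s' a = s a) -> Q s' -> Q' s') ->
  wp c Q' s.
Proof.
move=> h imp cs; have [t [s' [e l cs' q]]] := h cs.
exists t, s'; split=> //; apply: imp => //; exact: exec_frame e.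
Qed.

(* [Inv k s]: the loop is left from [s] after at most [k] more iterations. *)
Lemma wp_while e c (Inv : nat -> store -> Prop) (Q : store -> Prop) k s :
  k <= X -> Inv k s ->
  (forall k s', Inv k s' -> queries_capped s' e) ->
  (forall k s', (forall a, a \notin writes c -> s' a = s a) ->
     Inv k s' -> eval o s' e != 0 ->
     exists2 k', k = k'.+1 & wp c (Inv k') s') ->
  (forall k s', (forall a, a \notin writes c -> s' a = s a) ->
     Inv k s' -> eval o s' e = 0 -> Q s') ->
  wp (While e c) Q s.
Proof.
move=> kX inv qc step fin.
suff gen s1 : (forall a, a \notin writes c -> s1 a = s a) -> Inv k s1 -> capped s1 ->
    exists t s', [/\ exec o (While e c) s1 t s',
      t <= L.+1 * (k.+1 * esize e ^ 2 + k * cost X c), capped s' & Q s'].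
  move=> cs; have [//|t [s' [e' l cs' q]]] := gen s _ inv cs.
  exists t, s'; split=> //; apply: leq_trans l _ => /=.
  by rewrite leq_mul // leq_add // leq_mul.
elim: k {kX inv} s1 => [|k IH] s1 fr inv cs; have te := eval_time_le cs (qc _ _ inv).
  case: (altP (eval o s1 e =P 0)) => [z|nz]; last by have [] := step _ _ fr inv nz.
  exists (eval_time o s1 e), s1; split=> //; first exact: ExecWhileFalse.
    by apply: leq_trans te _; rewrite mul0n addn0 mul1n.
  exact: fin inv z.
case: (altP (eval o s1 e =P 0)) => [z|nz].
  exists (eval_time o s1 e), s1; split=> //; first exact: ExecWhileFalse.
    by apply: leq_trans te _; rewrite leq_mul // mulSn -addnA leq_addr.
  exact: fin inv z.
have [k' [<-] h] := step _ _ fr inv nz.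
have [t1 [s2 [e1 l1 cs2 inv2]]] := h cs.
have fr2 a : a \notin writes c -> s2 a = s a.
  by move=> ac; rewrite (exec_frame e1) // fr.
have [t2 [s3 [e2 l2 cs3 q]]] := IH s2 fr2 inv2 cs2.
exists (eval_time o s1 e + t1 + t2), s3; split=> //; first exact: ExecWhileTrue e1 e2.
apply: leq_trans (leq_add (leq_add te l1) l2) _.
by rewrite -!mulnDr leq_mul //; move: (cost X c) (esize e ^ 2) => A B; nia.
Qed.

End WeakestPrecondition.

(** * Local ratio for the covering problem *)

Definition update (x : nat -> nat) (j v : nat) : nat -> nat :=
  fun k => if k == j then v else x k.

Section Covering.
Variables (n M : nat) (p D : nat -> nat).
Implicit Types (x y l : nat -> nat) (w : nat -> nat -> nat).

Definition coverage x i := \sum_(j < n | i <= x j) p j.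
Definition deficit x i := D i - coverage x i.
Definition covering x := [forall i : 'I_M, D i <= coverage x i].
Definition weight w x := \sum_(j < n) w j (x j).

(* A raised job cannot be returned to its level in [l]. *)
Definition minimal_above l x := forall j, j < n -> l j < x j ->
  exists i, [/\ i < M, l j < i <= x j & coverage x i < D i + p j].

(** The competitor [y] ranges over all covers, not only those above [l], because an optimal cover
    need not follow the raises made by the algorithm. *)
Definition good w l x :=
  [/\ covering x, forall j, j < n -> l j <= x j < M, minimal_above l x &
      forall y, covering y -> (forall j, j < n -> y j < M) ->
        weight w x <= 4 * weight w y].

Definition prune x (jv : nat * nat) :=
  let x' := update x jv.1 jv.2 in if covering x' then x' else x.

Lemma cover_mono x y i : (forall j, j < n -> x j <= y j) -> coverage x i <= coverage y i.
Proof.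
move=> xy; rewrite /coverage big_mkcond [leqRHS]big_mkcond leq_sum // => j _.
by case: (leqP i (x j)) => [ij|_]; rewrite ?(leq_trans ij (xy _ _)) ?leq0n.
Qed.

Lemma cover_diff l x i : (forall j, j < n -> l j <= x j) ->
  coverage x i = coverage l i + \sum_(j < n | l j < i <= x j) p j.
Proof.
move=> lx; rewrite /coverage [RHS]addnC [X in X + _]big_mkcond [X in _ + X]big_mkcond.
rewrite -big_split /= big_mkcond; apply: eq_bigr => j _.
have := lx j (ltn_ord j); case: (leqP i (x j)); case: (ltnP (l j) i); rewrite /= ?andbF //; lia.
Qed.

Lemma cover_update x j v i : j < n ->
  coverage x i <= coverage (update x j v) i + (if v < i <= x j then p j else 0).
Proof.
move=> jn; rewrite /coverage big_mkcond (bigD1 (Ordinal jn)) //=.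
rewrite [X in _ <= X + _]big_mkcond [X in _ <= X + _](bigD1 (Ordinal jn)) //=.
set A := \sum_(_ < _ | _) _; set B := \sum_(_ < _ | _) _.
have -> : B = A.
  apply: eq_bigr => k /negPf kj; rewrite /update.
  by have -> : (k == j :> nat) = false by rewrite -kj.
by rewrite /update eqxx; case: (leqP i (x j)); case: (ltnP v i) => /=; lia.
Qed.

(** The knapsack-cover inequality. Either one job with [p j >= d] crosses [t] and pays [d] alone, or
    nothing is truncated and the crossing jobs make up for the deficit. *)
Lemma deficit_le_cover l y t : covering y -> t < M ->
  deficit l t <= \sum_(j < n | l j < t <= y j) minn (p j) (deficit l t).
Proof.
move=> /forallP/= cy tM; have /= Dt := cy (Ordinal tM); set d := deficit l t.
case: (pickP (fun j : 'I_n => (l j < t <= y j) && (d <= p j))) => [j /andP[jt dp]|no].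
  by rewrite (bigD1 j) //= (minn_idPr dp) leq_addr.
rewrite (eq_bigr (fun j : 'I_n => p j)); last first.
  by move=> j jt; have := no j; rewrite jt /= leqNgt => /negbFE/ltnW/minn_idPl.
rewrite leq_subLR (leq_trans Dt) // /coverage addnC big_mkcond [X in _ <= X + _]big_mkcond.
rewrite [X in _ <= _ + X]big_mkcond -big_split /= leq_sum // => j _.
by case: (leqP t (y j)); case: (ltnP (l j) t); rewrite /= ?andbF //; lia.
Qed.

(** Truncation bounds the share of [j0] by [d]. As [j0] is critical at [i], the other jobs raised
    across [i] fit into the deficit of [l] at [i], which is at most [d] again. *)
Lemma chain_le l x i d (J : pred 'I_n) (j0 : 'I_n) :
  (forall j, j < n -> l j <= x j) -> J j0 ->
  (forall j, J j -> l j < i <= x j) -> coverage x i < D i + p j0 -> deficit l i <= d ->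
  \sum_(j < n | J j) minn (p j) d <= 2 * d.
Proof.
move=> lx J0 Ji ci di; rewrite (bigD1 j0) //= mul2n -addnn leq_add ?geq_minr //.
have le_p : \sum_(j < n | J j) p j <= \sum_(j < n | l j < i <= x j) p j.
  rewrite big_mkcond [leqRHS]big_mkcond leq_sum // => j _.
  by case: ifP => // /Ji ->.
apply: leq_trans (_ : \sum_(j < n | J j && (j != j0)) p j <= _).
  by apply: leq_sum => j _; rewrite geq_minl.
rewrite (bigD1 j0) //= in le_p; move: ci di; rewrite (cover_diff i lx) /deficit.
set A := \sum_(_ < _ | _ && _) _ in le_p *; set B := \sum_(_ < _ | _) _ in le_p *.
lia.
Qed.

(* A job raised across [t] is critical at some point on one of the two sides of
   [t]; on each side, the critical point nearest to [t] bounds all the jobs. *)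
Lemma minimal_cover_le l x t d : (forall j, j < n -> l j <= x j) ->
  minimal_above l x -> (forall i, i < M -> deficit l i <= d) ->
  \sum_(j < n | l j < t <= x j) minn (p j) d <= 4 * d.
Proof.
move=> lx mx dm.
have /choice[c hc] : forall j : 'I_n, exists i, l j < x j ->
    [/\ i < M, l j < i <= x j & coverage x i < D i + p j].
  move=> j; case: (ltnP (l j) (x j)) => [lj|_]; last by exists 0.
  by have [i hi] := mx j (ltn_ord j) lj; exists i.
have cP (j : 'I_n) : l j < t <= x j -> [/\ c j < M, l j < c j <= x j & coverage x (c j) < D (c j) + p j].
  by case/andP=> a b; apply: hc; exact: leq_trans a b.
rewrite (bigID (fun j : 'I_n => t <= c j)) /= -[4]/(2 + 2) mulnDl leq_add //.
- pose J := [pred j : 'I_n | (l j < t <= x j) && (t <= c j)].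
  case: (pickP J) => [j1 J1|no]; last first.
    by rewrite big_pred0.
  case: (@arg_minnP _ j1 J c J1) => j0 J0 min0; have /andP[J0a J0b] := J0.
  have [cM _ cc] := cP _ J0a.
  (* Every job of [J] crosses [c j0], since [l j < t <= c j0 <= c j <= x j]. *)
  apply: (chain_le lx J0 _ cc (dm _ cM)) => j Jj; have cj := min0 j Jj.
  by case/andP: Jj => Jj _; have [_ /andP[_ ?] _] := cP _ Jj; lia.
- pose J := [pred j : 'I_n | (l j < t <= x j) && ~~ (t <= c j)].
  case: (pickP J) => [j1 J1|no]; last first.
    by rewrite big_pred0.
  case: (@arg_maxnP _ j1 J c J1) => j0 J0 max0; have /andP[J0a J0b] := J0.
  have [cM _ cc] := cP _ J0a.
  apply: (chain_le lx J0 _ cc (dm _ cM)) => j Jj; have cj := max0 j Jj.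
  by case/andP: Jj => Jj _; have [_ /andP[? _] _] := cP _ Jj; lia.
Qed.

(** The base of the local ratio recursion: weight 0 is optimal, and no job has been raised above
    [l]. *)
Lemma good_tight w l : covering l -> (forall j, j < n -> l j < M) ->
  (forall j, j < n -> w j (l j) = 0) -> good w l l.
Proof.
move=> cl lM tl; split=> //.
- by move=> j /lM ->; rewrite leqnn.
- by move=> j _; rewrite ltnn.
- by move=> y _ _; rewrite {1}/weight big1 // => j _; rewrite tl.
Qed.

Lemma prune_le l x j : (forall k, k < n -> update l j (l j) k <= x k) ->
  forall k, k < n -> l k <= prune x (j, l j) k <= x k.
Proof.
move=> lx k kn; have := lx k kn; rewrite /prune /=.
by case: (covering _); rewrite /update; case: (k =P j) => [->|_]; lia.
Qed.

Lemma covering_prune x jv : covering x -> covering (prune x jv).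
Proof. by rewrite /prune; case: ifP. Qed.

(** If [j] cannot be returned to [l j], the point that would become uncovered is critical for [j].
    For the other jobs the old critical points remain, as coverage only decreases. *)
Lemma minimal_prune l x j s : j < n -> l j < s -> covering x ->
  (forall k, k < n -> update l j s k <= x k) ->
  minimal_above (update l j s) x -> minimal_above l (prune x (j, l j)).
Proof.
move=> jn ls cx lx mx.
have lx' k : k < n -> l k <= prune x (j, l j) k <= x k.
  by apply: prune_le => {}k /lx; rewrite /update; case: (k =P j) => [->|]; lia.
have cv i : coverage (prune x (j, l j)) i <= coverage x i.
  by apply: cover_mono => k /lx' /andP[].
move=> k kn lk; case: (eqVneq k j) => [kj|kj].
  rewrite {k kn}kj in lk *; move: lk; rewrite /prune /=; case: ifP => [|nc lk].
    by rewrite /update eqxx ltnn.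
  have [i] : exists i : 'I_M, ~~ (D i <= coverage (update x j (l j)) i).
    by apply/existsP; rewrite -negb_forall -/(covering _) nc.
  rewrite -ltnNge => hi; have /forallP/(_ i) ci := cx; exists i.
  have := cover_update x (l j) i jn; case: ifP => [lij h|_ h]; last by lia.
  by split=> //; lia.
have [|i [iM ik ci]] := mx k kn.
  by rewrite /update (negPf kj); have /andP[_] := lx' k kn; lia.
move: ik; rewrite /update (negPf kj) => ik; exists i; split=> //.
  by move: ik; rewrite /prune /=; case: ifP => //; rewrite /update (negPf kj).
by have := cv i; lia.
Qed.

(** The local ratio step. The scaled weight [b * w] splits into [w'] and [a] times the model weight.
    The ratio 4 holds for [w'] by hypothesis, and for the model weight because a minimal solution
    pays at most [4 * d] and every cover at least [d]. *)
Lemma good_prune w w' l x t j s a b :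
  t < M -> (forall i, i < M -> deficit l i <= deficit l t) ->
  j < n -> l j < t <= s -> 0 < b ->
  (forall k, k < n -> w k (l k) = 0) ->
  (forall k i, k < n -> i < M ->
     b * w k i = w' k i + a * (if l k < t <= i then minn (p k) (deficit l t) else 0)) ->
  good w' (update l j s) x -> good w l (prune x (j, l j)).
Proof.
move=> tM dm jn ljs b0 tight split_w [cx lx mx opt].
have lx1 k : k < n -> update l j s k <= x k by case/lx/andP.
have ls : l j < s by lia.
have lx' k : k < n -> l k <= prune x (j, l j) k <= x k.
  by apply: prune_le => {}k /lx1; rewrite /update; case: (k =P j) => [->|]; lia.
have mx' := minimal_prune jn ls cx lx1 mx.
split=> //; first exact: covering_prune.
  by move=> k kn; have /andP[-> h] := lx' k kn; have /andP[_] := lx k kn; exact: leq_ltn_trans.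
move=> y cy yM; rewrite -(leq_pmul2l b0) mulnCA.
have splitW z : (forall k, k < n -> z k < M) ->
   b * weight w z = weight w' z + a * \sum_(k < n | l k < t <= z k) minn (p k) (deficit l t).
  move=> zM; rewrite /weight !big_distrr /= [X in _ + X]big_mkcond -big_split /=.
  by apply: eq_bigr => k _; rewrite split_w ?zM //; case: ifP; rewrite ?muln0.
rewrite !splitW //; last first.
  by move=> k kn; have /andP[_] := lx' k kn; have /andP[_] := lx k kn; lia.
rewrite mulnDr leq_add //.
  (* Pruning does not increase the weight for [w']: the splitting at [l j], where [w] vanishes,
     forces [w' j (l j) = 0]. *)
  apply: leq_trans (opt y cy yM); apply: leq_sum => k _; rewrite /prune /=.
  case: ifP => // _; rewrite /update; case: eqP => // ->.
  have := split_w j (l j) jn; rewrite tight // muln0.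
  have [|lM] := ltnP (l j) M; last by lia.
  by move=> _ /(_ isT); lia.
rewrite mulnCA leq_mul //; apply: leq_trans (_ : 4 * deficit l t <= _).
  by apply: minimal_cover_le => // k kn; case/andP: (lx' k kn).
by rewrite leq_mul // deficit_le_cover.
Qed.

End Covering.

(** * The algorithm *)

Declare Scope expr_scope.
Delimit Scope expr_scope with X.
Bind Scope expr_scope with expr.
Notation "# c" := (Const c) (at level 2, format "# c") : expr_scope.
Notation "e1 + e2" := (Op OpAdd e1 e2) : expr_scope.
Notation "e1 - e2" := (Op OpSub e1 e2) : expr_scope.
Notation "e1 * e2" := (Op OpMul e1 e2) : expr_scope.
Notation "e1 %/ e2" := (Op OpDiv e1 e2) : expr_scope.
Notation "e1 %% e2" := (Op OpMod e1 e2) : expr_scope.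
Notation "e1 <= e2" := (Op OpLeq e1 e2) : expr_scope.
Notation "e1 < e2" := (Op OpLeq (Op OpAdd e1 (Const 1)) e2) : expr_scope.

Definition var (a : nat) : expr := Cell a #0.
Definition set (a : nat) (e : expr) : cmd := Assign a #0 e.
Definition for_ (i : nat) (b : expr) (c : cmd) : cmd :=
  Seq (set i #0) (While (var i < b) (Seq c (set i (var i + #1)))).

Declare Scope cmd_scope.
Delimit Scope cmd_scope with C.
Bind Scope cmd_scope with cmd.
Notation "c1 ;; c2" := (Seq c1 c2)
  (at level 90, right associativity, format "c1 ;; '//' c2") : cmd_scope.

(* Scalar variables are cell 0 of their array. The weight of job [j] at level [i]
   is cell [j * M + i] of [aW], so that one loop over [aQ] runs over all pairs;
   [aHJob] and [aHLev] record the raised jobs and their former levels. *)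
Notation aN := 0 (only parsing).
Notation aP := 1 (only parsing).
Notation aOut := 2 (only parsing).
Notation aT := 3 (only parsing).
Notation aTau := 4 (only parsing).
Notation aM := 5 (only parsing).
Notation aLo := 6 (only parsing).
Notation aHi := 7 (only parsing).
Notation aMid := 8 (only parsing).
Notation aFlag := 9 (only parsing).
Notation aJ := 10 (only parsing).
Notation aW := 11 (only parsing).
Notation aQ := 12 (only parsing).
Notation aLev := 13 (only parsing).
Notation aI := 14 (only parsing).
Notation aCov := 15 (only parsing).
Notation aBest := 16 (only parsing).
Notation aArg := 17 (only parsing).
Notation aNum := 18 (only parsing).
Notation aDen := 19 (only parsing).
Notation aSel := 20 (only parsing).
Notation aLen := 21 (only parsing).
Notation aHJob := 22 (only parsing).
Notation aHLev := 23 (only parsing).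
Notation aOld := 24 (only parsing).

Definition total_prog : cmd := for_ aJ (var aN) (set aT (var aT + Cell aP (var aJ))).

Definition exceeds_prog (K : nat) : cmd :=
  (set aFlag #0;;
   for_ aJ (var aN)
     (If (#K.+1 * Query (var aJ) (Cell aTau (var aM)) < #K * Query (var aJ) (var aMid))
        (set aFlag #1) Skip))%C.

Definition bisect_prog (K : nat) : cmd :=
  While (var aLo + #2 <= var aHi)
    (set aMid ((var aLo + var aHi) %/ #2);;
     exceeds_prog K;;
     If (var aFlag) (set aHi (var aMid)) (set aLo (var aMid)))%C.

(** The search interval ends at the sentinel [T + 1], which becomes the last breakpoint and stops
    the loop. *)
Definition breakpoints_prog (K : nat) : cmd :=
  While (Cell aTau (var aM) <= var aT)
    (set aLo (Cell aTau (var aM));;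
     set aHi (var aT + #1);;
     bisect_prog K;;
     set aM (var aM + #1);;
     Assign aTau (var aM) (var aHi))%C.

Definition weights_prog : cmd :=
  for_ aQ (var aN * var aM)
    (Assign aW (var aQ) (Query (var aQ %/ var aM) (Cell aTau (var aQ %% var aM)))).

Definition deficit_prog : cmd :=
  (set aBest #0;;
   for_ aI (var aM)
     (set aCov #0;;
      for_ aJ (var aN)
        (If (var aI <= Cell aLev (var aJ)) (set aCov (var aCov + Cell aP (var aJ))) Skip);;
      set aCov (var aT - (Cell aTau (var aI) - #1) - var aCov);;
      If (var aBest < var aCov) (set aBest (var aCov);; set aArg (var aI)) Skip))%C.

(** With truncated subtraction, [a - (a - b)] is the minimum of [a] and [b]. *)
Definition min_expr : expr :=
  Cell aP (var aQ %/ var aM) - (Cell aP (var aQ %/ var aM) - var aBest).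

(** The product of two truth values is their conjunction. *)
Definition raises_expr : expr :=
  (Cell aLev (var aQ %/ var aM) < var aArg) * (var aArg <= var aQ %% var aM).

(* The initial value 1/0 of the minimum stands for infinity. *)
Definition select_prog : cmd :=
  (set aNum #1;; set aDen #0;;
   for_ aQ (var aN * var aM)
     (If (raises_expr * (Cell aW (var aQ) * var aDen < var aNum * min_expr))
        (set aNum (Cell aW (var aQ));; set aDen min_expr;; set aSel (var aQ)) Skip))%C.

Definition reweight_prog : cmd :=
  for_ aQ (var aN * var aM)
    (Assign aW (var aQ)
       (Cell aW (var aQ) * var aDen - raises_expr * (var aNum * min_expr))).

Definition push_prog : cmd :=
  (Assign aHJob (var aLen) (var aSel %/ var aM);;
   Assign aHLev (var aLen) (Cell aLev (var aSel %/ var aM));;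
   set aLen (var aLen + #1);;
   Assign aLev (var aSel %/ var aM) (var aSel %% var aM))%C.

Definition raise_prog : cmd :=
  (deficit_prog;;
   While (var aBest) (select_prog;; reweight_prog;; push_prog;; deficit_prog))%C.

Definition prune_prog : cmd :=
  While (var aLen)
    (set aLen (var aLen - #1);;
     set aOld (Cell aLev (Cell aHJob (var aLen)));;
     Assign aLev (Cell aHJob (var aLen)) (Cell aHLev (var aLen));;
     deficit_prog;;
     If (var aBest) (Assign aLev (Cell aHJob (var aLen)) (var aOld)) Skip)%C.

(** Orders the jobs lexicographically by level and index, as indices are below [n]. *)
Definition key_expr (i : nat) : expr := Cell aLev (var i) * var aN + var i.

Definition schedule_prog : cmd :=
  for_ aI (var aN)
    (for_ aJ (var aN)
       (If (key_expr aJ < key_expr aI)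
          (Assign aOut (var aI) (Cell aOut (var aI) + Cell aP (var aJ))) Skip)).

Definition algorithm (K : nat) : cmd :=
  (total_prog;; breakpoints_prog K;; weights_prog;; raise_prog;; prune_prog;;
   schedule_prog)%C.

Section Verification.
Variables (o : nat -> nat -> nat) (L X : nat).
Hypothesis L_gt0 : 0 < L.
Local Notation wp := (wp o L X).

Lemma wp_capped c Q s : (capped L s -> wp c Q s) -> wp c Q s.
Proof. by move=> h cs; exact: h. Qed.

Lemma wp_set a e (Q : store -> Prop) s :
  queries_capped o L s e -> eval o s e <= 2 ^ L ->
  Q (upd s a 0 (eval o s e)) -> wp (set a e) Q s.
Proof. by move=> *; apply: wp_assign. Qed.

(** The body has to establish the invariant for the store in which the counter is already advanced;
    the frame hypotheses refer back to the store before the loop. *)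
Lemma wp_for i b c N (Inv : nat -> store -> Prop) (Q : store -> Prop) s :
  N <= X -> N <= 2 ^ L -> i \notin writes c ->
  (forall s', queries_capped o L s' b) ->
  (forall s', (forall a, a \notin i :: writes c -> s' a = s a) -> eval o s' b = N) ->
  Inv 0 (upd s i 0 0) ->
  (forall k s', k < N -> (forall a, a \notin i :: writes c -> s' a = s a) ->
     s' i 0 = k -> Inv k s' -> wp c (fun s2 => Inv k.+1 (upd s2 i 0 k.+1)) s') ->
  (forall s', (forall a, a \notin i :: writes c -> s' a = s a) -> Inv N s' -> Q s') ->
  wp (for_ i b c) Q s.
Proof.
move=> NX NL ic qb eb inv0 step fin; apply: wp_seq; apply: wp_set => //.
pose Inv' r s' := exists2 k, k + r = N & [/\ s' i 0 = k, Inv k s' &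
   forall a, a \notin i :: writes c -> s' a = s a].
have fr0 : forall a, a \notin i :: writes c -> upd s i 0 0 a = s a.
  move=> a; rewrite inE negb_or => /andP[ai _].
  by apply/funext => k; rewrite /upd (negPf ai).
apply: (@wp_while o L X L_gt0 _ _ Inv' _ N) => //.
- by exists 0; split=> //; rewrite /upd !eqxx.
- move=> r s1 _ [k kr [ik inv fr]] /=; rewrite ik eb // addn1.
  case: (ltnP k N) => // kN _; exists (N - k.+1); first by lia.
  apply: wp_seq; apply: (wp_conseq (step _ _ kN fr ik inv)) => s2 fr2 inv2.
  apply: wp_set => //=; rewrite fr2 // ik addn1; first exact: leq_trans kN NL.
  exists k.+1; first by lia.
  split=> //; first by rewrite /upd !eqxx.
  move=> a; rewrite inE negb_or => /andP[ai ac].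
  by apply/funext => m; rewrite /upd (negPf ai) /= fr2 // fr // inE negb_or ai.
- move=> r s1 _ [k kr [ik inv fr]] /=; rewrite ik eb // addn1.
  case: (ltnP k N) => // Nk _; apply: fin => //.
  by have -> : N = k by lia.
Qed.

End Verification.

(** * Verification of the covering algorithm *)

Section Subroutines.
Variables (o : nat -> nat -> nat) (L X : nat).
Hypothesis L_gt0 : 0 < L.
Local Notation wp := (wp o L X).
Variables (n : nat) (p : nat -> nat).
Hypotheses (nX : n <= X) (nL : n <= 2 ^ L).
Let T := \sum_(j < n) p j.
Hypothesis TL : T.+1 <= 2 ^ L.

Lemma psum_le (A : pred nat) : \sum_(j < n | A j) p j <= T.
Proof. by rewrite /T [leqRHS](bigID (fun j : 'I_n => A j)) leq_addr. Qed.

Lemma psum_le_prefix (A : pred nat) k : k <= n -> \sum_(j < k | A j) p j <= T.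
Proof.
by move=> kn; rewrite (big_ord_widen_cond _ A p kn) (psum_le (fun j => A j && (j < k))).
Qed.

Lemma wp_total s : s aN 0 = n -> s aP = p -> s aT 0 = 0 ->
  wp total_prog (fun s' => s' aT 0 = T) s.
Proof.
move=> s0 s1 s3.
apply: (wp_for L_gt0 (N := n) (Inv := fun k s' => s' aT 0 = \sum_(j < k) p j)) => //.
- by move=> s' fr; rewrite /= fr.
- by rewrite big_ord0 /upd.
- move=> k s' kn fr ik inv.
  have vE : s' aT 0 + s' aP (s' aJ 0) = \sum_(j < k.+1) p j.
    by rewrite big_ord_recr /= inv ik fr // s1.
  apply: wp_set => //=.
    by rewrite vE; apply: leq_trans (psum_le_prefix predT kn) (ltnW TL).
Qed.

Variable M : nat.
Hypotheses (MX : M <= X) (ML : M <= 2 ^ L).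
Variable tau : nat -> nat.
(* Truncated subtraction: [D 0 = T] as [tau 0 = 0], and [D M = 0] as
   [tau M = T.+1]. *)
Let D i := T - (tau i - 1).

(** The data that stay fixed once the breakpoints are known. *)
Definition env (s : store) := [/\ s aN 0 = n, s aP = p, s aT 0 = T, s aTau = tau & s aM 0 = M].

Lemma env_frame (ws : seq nat) s s' : all (fun a => a \notin ws) [:: aN; aP; aT; aTau; aM] ->
  (forall a, a \notin ws -> s' a = s a) -> env s -> env s'.
Proof. by move=> /and5P[? ? ? ? /andP[? _]] fr [*]; split; rewrite fr. Qed.

Definition max_deficit (l : nat -> nat) (s : store) :=
  (forall i, i < M -> deficit n p D l i <= s aBest 0) /\
  (0 < s aBest 0 -> s aArg 0 < M /\ s aBest 0 = deficit n p D l (s aArg 0)).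

Lemma wp_deficit s : env s -> wp deficit_prog (max_deficit (s aLev)) s.
Proof.
move=> es; apply: wp_seq; apply: wp_set => //=.
set s1 := upd _ _ _ _.
have es1 : env s1 by case: es.
have l1 : s1 aLev = s aLev by [].
have b1 : s1 aBest 0 = 0 by [].
move: s1 es1 l1 b1 => {es} s1 es l1 b1.
apply: (wp_for L_gt0 (N := M) (Inv := fun k s' =>
  (forall i, i < k -> deficit n p D (s aLev) i <= s' aBest 0) /\
  (0 < s' aBest 0 -> s' aArg 0 < M /\ s' aBest 0 = deficit n p D (s aLev) (s' aArg 0)))) => //.
- by move=> s' fr; case: es => *; rewrite /= fr.
- by rewrite /upd /=; split=> //; rewrite b1.
- move=> k s2 kM fr ik [inv1 inv2].
  have es2 : env s2 by apply: env_frame fr es.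
  have [e0 e1 e3 e4 e5] := es2.
  have l2 : s2 aLev = s aLev by rewrite fr.
  apply: wp_seq; apply: wp_set => //=; apply: wp_seq.
  apply: (wp_for L_gt0 (N := n) (Inv := fun j s' => s' aCov 0 = \sum_(m < j | k <= s aLev m) p m)) => //.
  + by move=> s' fr'; rewrite /= fr' // /upd.
  + by rewrite big_ord0 /upd.
  + move=> j s' jn fr' ij inv; apply: wp_if => //=; rewrite ij !(fr' aI, fr' aLev) // /upd /= ik l2.
    * case: leqP => // kj _; have vE : s' aCov 0 + s' aP j = \sum_(m < j.+1 | k <= s aLev m) p m.
        by rewrite big_mkcond big_ord_recr -big_mkcond /= kj inv fr' // /upd /= e1.
      apply: wp_set => //=; rewrite ij ?vE //.
      by apply: leq_trans (psum_le_prefix (fun m => k <= s aLev m) jn) (ltnW TL).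
    * case: leqP => // kj _; apply: wp_skip => //.
      by rewrite big_mkcond big_ord_recr -big_mkcond /= leqNgt kj addn0.
  + move=> s' fr' inv; apply: wp_seq.
    have vE : s' aT 0 - (s' aTau (s' aI 0) - 1) - s' aCov 0 = deficit n p D (s aLev) k.
      by rewrite inv !(fr' aI, fr' aT, fr' aTau) // /upd /= ik e3 e4.
    apply: wp_set => //=; rewrite vE.
      by apply: leq_trans (leq_subr _ _) _; apply: leq_trans (leq_subr _ _) _; exact: ltnW.
    have [f13 f14 f16 f17] : [/\ s' aLev = s2 aLev, s' aI = s2 aI, s' aBest = s2 aBest & s' aArg = s2 aArg].
      by split; rewrite fr'.
    apply: wp_if => //=; rewrite /upd /= addn1.
    * case: leqP => // lt_b _; apply: wp_seq; apply: wp_set => //=.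
        by rewrite /upd /=; apply: leq_trans (leq_subr _ _) _; apply: leq_trans (leq_subr _ _) _; exact: ltnW.
      apply: wp_set => //=; first by rewrite /upd /= f14 ik; lia.
      rewrite /upd /= f14 ik; split=> [i|_]; last by split.
      rewrite ltnS leq_eqVlt => /orP[/eqP->//|/inv1].
      by rewrite -f16; lia.
    * case: leqP => // lt_b _; apply: wp_skip; rewrite /upd /= f16 f17 in lt_b *.
      split=> // i; rewrite ltnS leq_eqVlt => /orP[/eqP->//|/inv1 //].
Qed.

Lemma max_deficit0 l s : max_deficit l s -> covering n M p D l = (s aBest 0 == 0).
Proof.
case=> h1 h2; apply/forallP/idP => [cov|/eqP b0 i].
  rewrite -leqn0 leqNgt; apply/negP => b0; have [tM bE] := h2 b0.
  by have := cov (Ordinal tM); rewrite -subn_eq0 -[_ - _]bE -leqn0 leqNgt b0.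
by have := h1 i (ltn_ord i); rewrite b0 leqn0 subn_eq0.
Qed.


Hypotheses (nMX : n * M <= X) (nML : n * M <= 2 ^ L).
Hypothesis p_gt0 : forall j, j < n -> 0 < p j.

Definition raises (l : nat -> nat) t q := l (q %/ M) < t <= q %% M.
(** The model weight, seen as the rate at which the residual weight of the pair [q] decreases. *)
Definition slope d q := minn (p (q %/ M)) d.

Lemma eval_raises s : env s ->
  eval o s raises_expr = raises (s aLev) (s aArg 0) (s aQ 0).
Proof. by case=> *; rewrite /= addn1 mulnb /raises; congr (nat_of_bool _); congr (_ && _); congruence. Qed.

Lemma eval_min s : env s -> eval o s min_expr = slope (s aBest 0) (s aQ 0).
Proof. by case=> *; rewrite /= /slope minnE; congruence. Qed.

Lemma eval_better s : env s ->
  eval o s (raises_expr * (Cell aW (var aQ) * var aDen < var aNum * min_expr))%X =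
  raises (s aLev) (s aArg 0) (s aQ 0) &&
  (s aW (s aQ 0) * s aDen 0 < s aNum 0 * slope (s aBest 0) (s aQ 0)).
Proof.
move=> es; rewrite -eval_min // -mulnb -(addn1 (_ * s aDen 0)).
by rewrite -(eval_raises es).
Qed.

(** The fraction [aNum / aDen] is the least ratio of residual weight to slope; the comparison is
    cross-multiplied to stay within the natural numbers. *)
Definition selected (s s' : store) :=
  [/\ s' aSel 0 < n * M, raises (s aLev) (s aArg 0) (s' aSel 0),
      s' aNum 0 = s aW (s' aSel 0) /\ s' aDen 0 = slope (s aBest 0) (s' aSel 0),
      0 < s' aDen 0 &
      forall q, q < n * M -> raises (s aLev) (s aArg 0) q ->
        s' aNum 0 * slope (s aBest 0) q <= s aW q * s' aDen 0].

(** If no job were below [t], the coverage at [t] would be [T] and the deficit 0. A job below [t]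
    can be raised to [t] itself. *)
Lemma exists_raises l t : t < M -> 0 < deficit n p D l t ->
  exists2 q, q < n * M & raises l t q.
Proof.
move=> tM; case: (pickP (fun j : 'I_n => l j < t)) => [j lj _|no].
  exists (j * M + t); last by rewrite /raises divnMDl ?modnMDl ?divn_small ?modn_small ?addn0 ?lj; lia.
  apply: leq_trans (_ : j.+1 * M <= _); first by rewrite mulSn; lia.
  by rewrite leq_mul2r ltn_ord orbT.
have coverT : coverage n p l t = T by apply: eq_bigl => j; rewrite leqNgt no.
by rewrite /deficit coverT /D subn_gt0; lia.
Qed.

Lemma wp_select s : env s -> max_deficit (s aLev) s -> 0 < s aBest 0 ->
  wp select_prog (selected s) s.
Proof.
move=> es [_ md] d0; have [tM dE] := md d0.
apply: wp_seq; apply: wp_set => //=; first exact: leq_trans TL.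
apply: wp_seq; apply: wp_set => //=.
apply: (wp_for L_gt0 (N := n * M) (Inv := fun k s' =>
  [/\ forall q, q < k -> raises (s aLev) (s aArg 0) q ->
        s' aNum 0 * slope (s aBest 0) q <= s aW q * s' aDen 0,
      s' aDen 0 = 0 -> s' aNum 0 = 1 &
      0 < s' aDen 0 -> [/\ s' aSel 0 < n * M, raises (s aLev) (s aArg 0) (s' aSel 0),
      s' aNum 0 = s aW (s' aSel 0) & s' aDen 0 = slope (s aBest 0) (s' aSel 0)]])) => //.
- by move=> s' fr; case: es => *; rewrite /= !fr // /upd /=; congr (_ * _).
- move=> k s' kn fr ik [inv1 inv2 inv3].
  have es' : env s' by apply: env_frame fr _ => //; case: es.
  have [f11 f13 f16 f17] : [/\ s' aW = s aW, s' aLev = s aLev, s' aBest = s aBest & s' aArg = s aArg].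
    by split; rewrite fr.
  apply: wp_capped => cs; apply: (wp_if L_gt0).
  + by [].
  + rewrite eval_better // ik f11 f13 f16 f17 eqb0 negbK => /andP[rk lt].
    apply: wp_seq; apply: wp_set => //=.
    set s2 := upd s' aNum 0 _; have es2 : env s2 by case: es'.
    apply: wp_seq; apply: wp_set => //.
      rewrite eval_min // /slope /s2 /upd /= f16; apply: leq_trans (geq_minr _ _) _.
      by rewrite -f16; exact: cs.
    have -> : eval o s2 min_expr = slope (s aBest 0) k.
      by rewrite eval_min // /s2 /upd /= f16 ik.
    apply: wp_set => //=; rewrite /s2 /upd /= ik ?f11; first exact: leq_trans (ltnW kn) nML.
    split=> //.
    * move=> q; rewrite ltnS leq_eqVlt => /orP[/eqP-> _|/inv1 h /h {}h]; first by [].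
      (* Transitivity of the comparison of fractions; against the initial 1/0, the earlier
         inequality forces the slope of [q] to be 0. *)
      case: (posnP (s' aDen 0)) => [z|pos]; first by move: h; rewrite z (inv2 z); lia.
      rewrite -(leq_pmul2r pos); move: lt h; move: (slope _ k) (slope _ q) => a b.
      by move: (s' aNum 0) (s' aDen 0) (s aW k) (s aW q) => c d e g; nia.
    * by move=> z; move: lt; rewrite z muln0.
  + rewrite eval_better // ik f11 f13 f16 f17 => /eqP; rewrite eqb0 => no.
    apply: wp_skip; split=> // q; rewrite ltnS leq_eqVlt => /orP[/eqP-> rk|/inv1 //].
    by move: no; rewrite rk /= -leqNgt.
- move=> s' fr [inv1 inv2 inv3].
  (* The initial 1/0 does not survive: some pair raises across [t], and its slope is positive. *)
  have pos : 0 < s' aDen 0.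
    rewrite lt0n; apply/eqP => z; rewrite dE in d0; have [q qn rq] := exists_raises tM d0.
    have := inv1 q qn rq; rewrite z (inv2 z) muln0 mul1n leqn0 => /eqP.
    have jn : q %/ M < n by rewrite ltn_divLR //; lia.
    by have := p_gt0 jn; rewrite /slope dE; lia.
  by have [*] := inv3 pos; split.
Qed.

Lemma wp_reweight s : env s -> (forall q, q < n * M -> s aW q * s aDen 0 <= 2 ^ L) ->
  wp reweight_prog (fun s' => forall q, q < n * M -> s' aW q =
     s aW q * s aDen 0 - (if raises (s aLev) (s aArg 0) q then s aNum 0 * slope (s aBest 0) q else 0)) s.
Proof.
move=> es wL.
apply: (wp_for L_gt0 (N := n * M) (Inv := fun k s' => forall q, s' aW q =
  if q < k then s aW q * s aDen 0 - (if raises (s aLev) (s aArg 0) q then s aNum 0 * slope (s aBest 0) q else 0)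
  else s aW q)) => //.
- by move=> s' fr; case: es => *; rewrite /= !fr // /upd /=; congr (_ * _).
- move=> k s' kn fr ik inv.
  have es' : env s' by apply: env_frame fr es.
  have [f13 f16 f17] : [/\ s' aLev = s aLev, s' aBest = s aBest & s' aArg = s aArg] by split; rewrite fr.
  have vE : eval o s' (Cell aW (var aQ) * var aDen - raises_expr * (var aNum * min_expr))%X =
     s aW k * s aDen 0 - (if raises (s aLev) (s aArg 0) k then s aNum 0 * slope (s aBest 0) k else 0).
    rewrite [LHS]/(s' aW (s' aQ 0) * s' aDen 0 - eval o s' raises_expr * (s' aNum 0 * eval o s' min_expr)).
    rewrite eval_raises // eval_min // ik inv ltnn f13 f16 f17 !(fr aDen, fr aNum) //.
    by case: raises; rewrite ?mul1n ?mul0n.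
  apply: wp_assign; rewrite // ?vE; first by apply: leq_trans (leq_subr _ _) (wL _ kn).
  rewrite /= ik => q; rewrite /upd /= inv ltnS; case: (ltngtP q k) => // -> //.
- by move=> s' fr inv q qn; rewrite inv qn.
Qed.


Definition table (s : store) (k i : nat) := s aW (k * M + i).

Lemma index_lt k i : k < n -> i < M -> k * M + i < n * M.
Proof.
move=> kn iM; apply: leq_trans (_ : k.+1 * M <= _); first by rewrite mulSn; lia.
by rewrite leq_mul2r kn orbT.
Qed.

Lemma raises_index l t k i : i < M -> raises l t (k * M + i) = (l k < t <= i).
Proof. by move=> iM; rewrite /raises divnMDl ?modnMDl ?divn_small ?modn_small ?addn0; lia. Qed.

Lemma slope_index d k i : i < M -> slope d (k * M + i) = minn (p k) d.
Proof. by move=> iM; rewrite /slope divnMDl ?divn_small ?addn0; lia. Qed.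

(** The sum of the levels is the termination measure of the raising loop. *)
Lemma sum_update l j v : j < n -> l j < v ->
  \sum_(k < n) l k < \sum_(k < n) update l j v k.
Proof.
move=> jn lv; rewrite (bigD1 (Ordinal jn)) //= [ltnRHS](bigD1 (Ordinal jn)) //=.
rewrite (_ : \sum_(k < n | k != Ordinal jn) update l j v k = \sum_(k < n | k != Ordinal jn) l k).
  by rewrite /update eqxx ltn_add2r.
apply: eq_bigr => k /negPf kj; rewrite /update.
by have -> : (k == j :> nat) = false by rewrite -kj.
Qed.

(** The effect of [prune_prog] as a function, latest raise first. *)
Fixpoint unwind (h v : nat -> nat) (k : nat) (x : nat -> nat) : nat -> nat :=
  if k is k'.+1 then unwind h v k' (prune n M p D x (h k', v k')) else x.

Lemma eq_unwind h v h' v' k x : (forall i, i < k -> h i = h' i /\ v i = v' i) ->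
  unwind h v k x = unwind h' v' k x.
Proof.
elim: k x => //= k IH x eq_hv; have [-> ->] := eq_hv k (leqnn _).
by apply: IH => i ik; apply: eq_hv; exact: leqW.
Qed.

Variable F : nat.
Hypothesis FL : F * T.+1 ^ (n * M) <= 2 ^ L.

(* [raise_sound] is the local ratio argument in continuation-passing style:
   pruning turns any good solution above the present levels into a good solution
   for the initial weights. *)
Record raise_inv (s0 : store) (r : nat) (s : store) : Prop := RaiseInv {
  raise_env : env s;
  raise_max : max_deficit (s aLev) s;
  raise_lt : forall j, j < n -> s aLev j < M;
  raise_tight : forall j, j < n -> table s j (s aLev j) = 0;
  raise_len : s aLen 0 <= \sum_(j < n) s aLev j;
  raise_fuel : n * M <= \sum_(j < n) s aLev j + r;
  raise_bound : forall q, q < n * M -> s aW q <= F * T.+1 ^ s aLen 0;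
  raise_sound : forall x, good n M p D (table s) (s aLev) x ->
    good n M p D (table s0) (s0 aLev) (unwind (s aHJob) (s aHLev) (s aLen 0) x) }.

Lemma wp_raise_step s0 r s : raise_inv s0 r s -> 0 < s aBest 0 ->
  exists2 r', r = r'.+1 & wp (select_prog;; reweight_prog;; push_prog;; deficit_prog)%C
    (raise_inv s0 r') s.
Proof.
move=> [es md lM tight len fuel bound sound] d0; have [tM dE] := proj2 md d0.
have [q0 q0n rq0] : exists2 q, q < n * M & raises (s aLev) (s aArg 0) q.
  by apply: exists_raises; rewrite // -dE.
have M0 : 0 < M by exact: leq_ltn_trans tM.
have lt_nM : \sum_(j < n) s aLev j < n * M.
  have jn : q0 %/ M < n by rewrite ltn_divLR //; lia.
  have -> : n * M = \sum_(j < n) M by rewrite sum_nat_const card_ord.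
  rewrite (bigD1 (Ordinal jn)) //= [ltnRHS](bigD1 (Ordinal jn)) //=.
  by rewrite -addSn leq_add ?lM // leq_sum // => k _; exact/ltnW/lM.
case: r fuel => [|r] fuel; first by lia.
exists r => //; apply: wp_seq; apply: (wp_conseq (wp_select es md d0)) => s1 fr1.
case=> qn rq [numE denE] den0 mins; set q := s1 aSel 0 in qn rq numE denE.
have es1 : env s1 by apply: env_frame fr1 es.
have denT : s1 aDen 0 <= T.
  rewrite denE /slope (leq_trans (geq_minr _ _)) // dE /deficit.
  by rewrite (leq_trans (leq_subr _ _)) // leq_subr.
have jn : q %/ M < n by rewrite ltn_divLR //; lia.
have sM : q %% M < M by rewrite ltn_mod.
have [f11 f13 f16 f17 f21] : [/\ s1 aW = s aW, s1 aLev = s aLev, s1 aBest = s aBest, s1 aArg = s aArg & s1 aLen = s aLen].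
  by split; rewrite fr1.
have [f22 f23] : s1 aHJob = s aHJob /\ s1 aHLev = s aHLev by split; rewrite fr1.
(* Each iteration scales by [aDen <= T]. The number of raises is at most the sum of the levels,
   which is still below [n * M], so the exponent stays within [FL]. *)
have expL q' : q' < n * M -> s aW q' * s1 aDen 0 <= F * T.+1 ^ (s aLen 0).+1.
  by move=> /bound b; rewrite expnSr mulnA leq_mul // ltnW.
apply: wp_seq; apply: (wp_conseq (wp_reweight es1 _)) => [q' q'n|s2 fr2 w2].
  rewrite f11; apply: leq_trans (expL _ q'n) (leq_trans _ FL).
  by rewrite leq_mul2l leq_pexp2l ?orbT //; lia.
rewrite f11 f13 f16 f17 in w2.
have es2 : env s2 by apply: env_frame fr2 es1.
have [g13 g20 g21 g22 g23] : [/\ s2 aLev = s aLev, s2 aSel 0 = q, s2 aLen = s aLen, s2 aHJob = s aHJob & s2 aHLev = s aHLev].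
  by split; rewrite fr2.
have g5 : s2 aM 0 = M by case: es2.
apply: wp_seq; apply: wp_capped => cs2.
apply: wp_seq; apply: wp_assign => //=; rewrite g20 g5.
  by apply: leq_trans (ltnW jn) nL.
apply: wp_seq; apply: wp_assign => //=; rewrite /upd /= ?g20 ?g5 ?g21 ?g13.
  by rewrite -g13.
apply: wp_seq; apply: wp_set => //=; rewrite /upd /= ?g21 addn1.
  by apply: leq_trans nML; lia.
apply: wp_assign => //=; rewrite /upd /= ?g20 ?g5.
  by apply: leq_trans (ltnW sM) ML.
set s4 := (fun b k : nat => _).
have es4 : env s4 by case: es2.
have l4 : s4 aLev = update (s aLev) (q %/ M) (q %% M) by rewrite -g13.
have k4 : s4 aLen 0 = (s aLen 0).+1 by [].
have w4 : s4 aW = s2 aW by [].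
have h4 i : i < s aLen 0 -> s4 aHJob i = s aHJob i /\ s4 aHLev i = s aHLev i.
  by move=> ik; rewrite /s4 /= -g22 -g23 (ltn_eqF ik).
have h4k : s4 aHJob (s aLen 0) = q %/ M /\ s4 aHLev (s aLen 0) = s aLev (q %/ M).
  by rewrite /s4 /= eqxx.
move: s4 es4 l4 k4 w4 h4 h4k => s4 es4 l4 k4 w4 h4 h4k.
apply: (wp_conseq (wp_deficit es4)) => s5 fr5 md5.
have [f5_11 f5_13 f5_21 f5_22 f5_23] : [/\ s5 aW = s4 aW, s5 aLev = s4 aLev, s5 aLen = s4 aLen, s5 aHJob = s4 aHJob & s5 aHLev = s4 aHLev].
  by split; rewrite fr5.
have sum5 := sum_update jn (_ : s aLev (q %/ M) < q %% M).
have ls : s aLev (q %/ M) < q %% M by case/andP: rq; exact: leq_trans.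
have {sum5} := sum5 ls; rewrite -l4 -f5_13 => sum5.
have tab k i : k < n -> i < M -> table s5 k i =
    table s k i * s1 aDen 0 - s1 aNum 0 * (if s aLev k < s aArg 0 <= i then minn (p k) (s aBest 0) else 0).
  move=> kn iM; rewrite /table f5_11 w4 w2 ?index_lt // raises_index // slope_index //.
  by case: ifP; rewrite ?muln0.
split.
- by apply: env_frame fr5 es4.
- by rewrite f5_13.
- by move=> j jn'; rewrite f5_13 l4 /update; case: eqP => // _; exact: lM.
(* The selected pair attains the least ratio, so its residual weight becomes 0; at the levels of the
   other jobs a zero weight remains zero. *)
- move=> j jn'; rewrite f5_13 l4 /update; case: (eqVneq j (q %/ M)) => [->|jq].
    rewrite tab // -raises_index // -(slope_index _ _ sM) /table -divn_eq rq denE numE.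
    by rewrite subnn.
  by rewrite tab ?lM // tight.
- by rewrite f5_21 k4; lia.
- by lia.
- move=> q' q'n; rewrite f5_11 w4 w2 // f5_21 k4.
  by apply: leq_trans (leq_subr _ _) (expL _ q'n).
- move=> x; rewrite f5_13 l4 f5_21 k4 f5_22 f5_23 => gx /=.
  have [-> ->] := h4k; rewrite (eq_unwind _ h4); apply: sound.
  (* Here [b] is [aDen]; minimality of the ratio ensures that no subtraction in the new table was
     truncated. *)
  apply: (good_prune (a := s1 aNum 0) tM _ jn _ den0 tight _ gx).
  + by move=> i iM; rewrite -dE; exact: (proj1 md).
  + exact: rq.
  + move=> k i kn iM; rewrite tab // -dE mulnC subnK //.
    have := mins _ (index_lt kn iM); rewrite raises_index // slope_index //.
    by case: ifP => // _ h; rewrite ?muln0 // h.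
Qed.

Lemma wp_raise s : env s -> (forall j, j < n -> s aLev j = 0) ->
  (forall j, j < n -> table s j 0 = 0) -> 0 < M -> s aLen 0 = 0 ->
  (forall q, q < n * M -> s aW q <= F) ->
  wp raise_prog (fun s' =>
    good n M p D (table s) (s aLev) (unwind (s' aHJob) (s' aHLev) (s' aLen 0) (s' aLev)) /\
    s' aLen 0 <= n * M) s.
Proof.
move=> es l0 w0 M0 k0 wF; apply: wp_seq.
apply: (wp_conseq (wp_deficit es)) => s1 fr1 md1.
have [f11 f13 f21 f22 f23] : [/\ s1 aW = s aW, s1 aLev = s aLev, s1 aLen = s aLen, s1 aHJob = s aHJob & s1 aHLev = s aHLev].
  by split; rewrite fr1.
apply: (wp_while L_gt0 (Inv := raise_inv s) nMX) => //.
- split.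
  + by apply: env_frame fr1 es.
  + by rewrite f13.
  + by move=> j /l0; rewrite f13 => ->.
  + by move=> j jn; rewrite f13 l0 // /table f11; exact: w0.
  + by rewrite f21 k0.
  + by rewrite leq_addl.
  + by move=> q /wF; rewrite f11 f21 k0 muln1.
  + by move=> x; rewrite f21 k0 f13 /table f11.
- move=> r s2 _ inv /=; rewrite -lt0n => d0; exact: wp_raise_step inv d0.
- move=> r s2 _ [es2 md2 lM tight len fuel bound sound] /= b0; split.
    (* On exit the levels are a tight cover, hence good for the residual weights; [sound] carries
       this back to the initial ones. *)
    by apply/sound/good_tight => //; rewrite (max_deficit0 md2) b0.
  apply: leq_trans len _; have -> : n * M = \sum_(j < n) M by rewrite sum_nat_const card_ord.
  apply: leq_sum => j _.
  exact/ltnW/lM.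
Qed.


Lemma wp_prune s : env s -> s aLen 0 <= X ->
  wp prune_prog (fun s' => s' aLev = unwind (s aHJob) (s aHLev) (s aLen 0) (s aLev)) s.
Proof.
move=> es kX; apply: (wp_while L_gt0 (Inv := fun r s' => [/\ env s', s' aLen 0 = r &
   unwind (s aHJob) (s aHLev) r (s' aLev) = unwind (s aHJob) (s aHLev) (s aLen 0) (s aLev)]) kX) => //.
- move=> r s1 fr [es1 rE inv] /=; rewrite rE; case: r rE inv => // r rE inv _; exists r => //.
  have [f22 f23] : s1 aHJob = s aHJob /\ s1 aHLev = s aHLev by split; rewrite fr.
  apply: wp_capped => cs.
  apply: wp_seq; apply: wp_set => //=; rewrite rE subn1 /=.
    by rewrite -ltnS -rE ltnW // ltnS cs.
  apply: wp_seq; apply: wp_set => //=; rewrite /upd /=; first exact: cs.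
  apply: wp_seq; apply: wp_assign => //=; rewrite /upd /=.
  set s2 := (fun b k : nat => _).
  have es2 : env s2 by case: es1.
  have [l2 v2] : s2 aLev = update (s1 aLev) (s aHJob r) (s aHLev r) /\ s2 aOld 0 = s1 aLev (s aHJob r).
    by rewrite -f22 -f23.
  have [h2 k2] : s2 aHJob = s aHJob /\ s2 aLen 0 = r by rewrite -f22.
  move: s2 es2 l2 v2 h2 k2 => s2 es2 l2 v2 h2 k2.
  apply: wp_seq; apply: (wp_conseq (wp_deficit es2)) => s3 fr3 md3.
  have es3 : env s3 by apply: env_frame fr3 es2.
  have [f13 f24 f21 f22'] : [/\ s3 aLev = s2 aLev, s3 aOld = s2 aOld, s3 aLen = s2 aLen & s3 aHJob = s2 aHJob].
    by split; rewrite fr3.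
  have cov := max_deficit0 md3; rewrite l2 in cov.
  apply: (wp_if L_gt0) => //= b.
    apply: wp_capped => cs3; apply: wp_assign => //=.
    rewrite f21 f22' h2 k2 f24 v2; split; [by case: es3 | by rewrite /upd /= f21 |].
    rewrite -inv /= /prune /= cov (negPf b); congr unwind; apply/funext => i.
    by rewrite /upd /= f13 l2 /update; case: eqP => // ->.
  apply: wp_skip; split; rewrite ?f21 // f13 l2 -inv /= /prune /= cov b eqxx //.
- by move=> r s1 _ [_ rE inv] /= k0; rewrite -inv -rE k0.
Qed.

Definition key (l : nat -> nat) j := l j * n + j.

Lemma wp_schedule s : env s -> (forall j, s aOut j = 0) ->
  wp schedule_prog (fun s' => forall j, j < n ->
    s' aOut j = \sum_(k < n | key (s aLev) k < key (s aLev) j) p k) s.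
Proof.
move=> es out0.
apply: (wp_for L_gt0 (N := n) (Inv := fun i s' => forall j, j < n -> s' aOut j =
   if j < i then \sum_(k < n | key (s aLev) k < key (s aLev) j) p k else 0)) => //.
- by move=> s' fr; case: es => *; rewrite /= fr.
- by move=> j _; rewrite /upd /= out0.
- move=> i s1 iN fr iE inv.
  have es1 : env s1 by apply: env_frame fr es.
  have f13 : s1 aLev = s aLev by rewrite fr.
  apply: (wp_for L_gt0 (N := n) (Inv := fun m s' => forall j, j < n -> s' aOut j =
    if j == i then \sum_(k < m | key (s aLev) k < key (s aLev) i) p k else s1 aOut j)) => //.
  + by move=> s' fr'; case: es1 => *; rewrite /= fr'.
  + move=> j jn; rewrite big_ord0 /upd /=; case: eqP => // ->.
    by rewrite inv // ltnn.
  + move=> m s2 mn fr2 mE inv2.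
    have es2 : env s2 by apply: env_frame fr2 es1.
    have [e0 e1 _ _ _] := es2.
    have f13' : s2 aLev = s aLev by rewrite fr2.
    have f14 : s2 aI 0 = i by rewrite fr2.
    have big_step : \sum_(k < m.+1 | key (s aLev) k < key (s aLev) i) p k =
      \sum_(k < m | key (s aLev) k < key (s aLev) i) p k + (if key (s aLev) m < key (s aLev) i then p m else 0).
      by rewrite big_mkcond big_ord_recr -big_mkcond.
    apply: (wp_if L_gt0) => //=; rewrite mE f14 e0 f13' addn1 -/(key (s aLev) m) -/(key (s aLev) i).
    * case: leqP => // lt _; apply: wp_assign => //=; rewrite f14 mE inv2 // eqxx e1.
        rewrite -[p m]/(if true then p m else 0) -lt -big_step.
        by apply: leq_trans (psum_le_prefix (fun k => key (s aLev) k < key (s aLev) i) mn) (ltnW TL).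
      move=> j jn; rewrite /upd /= inv2 //; case: eqP => // _.
      by rewrite big_step lt.
    * case: leqP => // lt _; apply: wp_skip => j jn; rewrite /upd /= inv2 // big_step.
      by rewrite ltnNge lt addn0.
  + move=> s2 fr2 inv2 j jn; rewrite /upd /= inv2 // inv // ltnS.
    by case: (ltngtP j i) => // ->.
- by move=> s1 fr1 inv j jn; rewrite inv // jn.
Qed.

Lemma wp_weights s : env s -> 0 < M -> F <= 2 ^ L ->
  (forall j i, j < n -> i < M -> o j (tau i) <= F) ->
  wp weights_prog (fun s' => (forall j i, j < n -> i < M -> table s' j i = o j (tau i)) /\
    (forall q, q < n * M -> s' aW q <= F)) s.
Proof.
move=> es M0 FL' oF.
have jn k : k < n * M -> k %/ M < n by rewrite ltn_divLR.
have im k : k %% M < M by rewrite ltn_mod.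
apply: (wp_for L_gt0 (N := n * M) (Inv := fun k s' => forall q, q < k ->
   s' aW q = o (q %/ M) (tau (q %% M)))) => //.
- by move=> s' fr; case: es => *; rewrite /= !fr //; congr (_ * _).
- move=> k s1 kn fr kE inv.
  have [e0 e1 e3 e4 e5] : env s1 by apply: env_frame fr es.
  apply: wp_assign => //=; rewrite kE e5 e4.
  + by split=> //; apply: leq_trans FL'; rewrite oF ?jn.
  + by apply: leq_trans FL'; rewrite oF ?jn.
  + move=> q; rewrite /upd /= ltnS leq_eqVlt => /orP[/eqP->|qk]; first by rewrite eqxx.
    by rewrite (ltn_eqF qk) inv.
- move=> s1 fr inv; split=> [j i jn' iM|q qn].
    by rewrite /table inv ?index_lt // divnMDl // modnMDl divn_small // modn_small // addn0.
  by rewrite inv // oF ?jn.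
Qed.

End Subroutines.

(** * Rounding of the cost functions *)

Section GeometricRank.
Variable K : nat.
Hypothesis K_gt0 : 0 < K.

(* By Bernoulli's inequality, [v ^ K] doubles when [v] grows by a factor
   [1 + 1/K]. *)
Definition rank (v : nat) := trunc_log 2 (2 * v ^ K).

(** This is [(1 + 1/K)^j >= 1 + j/K], multiplied by [K ^ j.+1]. *)
Lemma bernoulli j : K ^ j * (K + j) <= K * K.+1 ^ j.
Proof.
elim: j => [|j IH]; first by rewrite addn0 !expn0 mul1n muln1.
apply: leq_trans (_ : K.+1 * (K ^ j * (K + j)) <= _); last first.
  by rewrite expnS (mulnCA K) leq_mul.
rewrite expnS; move: (K ^ j) => A; nia.
Qed.

Lemma rank_mono v v' : v <= v' -> rank v <= rank v'.
Proof. by move=> h; rewrite leq_trunc_log // leq_mul // leq_exp2r. Qed.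

(** Bernoulli's inequality with [j = K] gives [2 * v ^ K <= v' ^ K], so the binary logarithm grows
    by at least 1. *)
Lemma rank_lt v v' : K.+1 * v < K * v' -> rank v < rank v'.
Proof.
move=> h; rewrite /rank; case: (posnP v) h => [->|v0] h.
  (* The factor 2 in [rank] separates the value 0, of rank 0, from the positive values, of rank at
     least 1. *)
  have v'0 : 0 < v' by lia.
  by rewrite exp0n // muln0 trunc_log0 trunc_log_gt0 //= leq_pmulr // expn_gt0 v'0.
have K2 : 2 * K ^ K <= K.+1 ^ K.
  by rewrite -(leq_pmul2l K_gt0) mulnA; have := bernoulli K; rewrite addnn; lia.
have le2 : 2 * v ^ K <= v' ^ K.
  rewrite -(@leq_pmul2l (K ^ K)) ?expn_gt0 ?K_gt0 // mulnCA mulnA.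
  apply: leq_trans (_ : K.+1 ^ K * v ^ K <= _); first by rewrite leq_mul.
  by rewrite -!expnMn leq_exp2r // ltnW.
apply: leq_trans (leq_trunc_log 2 (_ : 2 * (2 * v ^ K) <= _)); last by rewrite leq_mul.
by rewrite (mul2n (2 * _)) trunc_log2_double // muln_gt0 expn_gt0 v0.
Qed.

End GeometricRank.

(** * Computation of the breakpoints and a bound on their number *)

Section Breakpoints.
Variables (o : nat -> nat -> nat) (L X : nat).
Hypothesis L_gt0 : 0 < L.
Local Notation wp := (wp o L X).
Variables (K n T F : nat).
Hypotheses (K_gt0 : 0 < K) (nX : n <= X) (nL : n <= 2 ^ L).
Hypotheses (TX : T.+1 <= 2 ^ X) (TL : T.+1 <= 2 ^ L) (FL : F <= 2 ^ L).
Hypothesis o_mono : forall j, {homo o j : t t' / t <= t'}.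
Hypothesis oF : forall j t, j < n -> t <= T -> o j t <= F.
Hypotheses (rX : (n * rank K F).+1 <= X) (rL : (n * rank K F).+1 <= 2 ^ L).

Definition exceeds k a b := has (fun j => K.+1 * o j a < K * o j b) (iota 0 k).

Lemma exceedsS k a b :
  exceeds k.+1 a b = exceeds k a b || (K.+1 * o k a < K * o k b).
Proof. by rewrite /exceeds -(addn1 k) iotaD has_cat /= orbF. Qed.

Lemma exceeds_mono k a b b' : b <= b' -> exceeds k a b -> exceeds k a b'.
Proof.
move=> bb /hasP[j jk h]; apply/hasP; exists j => //.
by apply: leq_trans h _; rewrite leq_mul // o_mono.
Qed.

Lemma exceedsNP k a b : ~~ exceeds k a b -> forall j, j < k -> K * o j b <= K.+1 * o j a.
Proof.
by move=> /hasPn h j jk; have := h j; rewrite mem_iota add0n jk -leqNgt; apply.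
Qed.

Lemma wp_exceeds s : s aN 0 = n -> s aTau (s aM 0) <= T -> s aMid 0 <= T ->
  wp (exceeds_prog K) (fun s' => s' aFlag 0 = exceeds n (s aTau (s aM 0)) (s aMid 0)) s.
Proof.
move=> s0 aTle bTle; apply: wp_seq; apply: wp_set => //=.
apply: (wp_for L_gt0 (N := n) (Inv := fun k s' =>
  s' aFlag 0 = exceeds k (s aTau (s aM 0)) (s aMid 0))) => //.
- by move=> s' fr; rewrite /= fr.
- move=> k s' kn fr kE inv; have [f4 f5 f8] : [/\ s' aTau = s aTau, s' aM = s aM & s' aMid = s aMid].
    by split; rewrite fr.
  apply: (wp_if L_gt0).
  + by rewrite /= kE f4 f5 f8; do !split=> //; apply: leq_trans FL; apply: oF.
  + rewrite /= kE f4 f5 f8 addn1 eqb0 negbK => h.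
    apply: wp_set => //=; first by rewrite expn_gt0.
    by rewrite exceedsS h orbT.
  + rewrite /= kE f4 f5 f8 addn1 => /eqP; rewrite eqb0 => /negPf h.
    by apply: wp_skip; rewrite exceedsS h orbF.
Qed.

Definition next_break a b :=
  [/\ a < b <= T.+1, (forall c, c < b -> ~~ exceeds n a c) & (b <= T -> exceeds n a b)].

(** Binary search is sound because [exceeds] is monotone in its last argument. The gap falls from at
    most [2 ^ r.+1] to at most [2 ^ r] per round, and [T.+1 <= 2 ^ X]. *)
Lemma wp_bisect s : s aN 0 = n -> s aTau (s aM 0) <= T -> s aLo 0 = s aTau (s aM 0) ->
  s aHi 0 = T.+1 -> wp (bisect_prog K) (fun s' => next_break (s aTau (s aM 0)) (s' aHi 0)) s.
Proof.
move=> s0 aTle s6 s7; set a := s aTau (s aM 0) in aTle s6 *.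
apply: (wp_while L_gt0 (k := X) (Inv := fun r s' => [/\ a <= s' aLo 0 < s' aHi 0,
  s' aHi 0 <= T.+1, s' aHi 0 - s' aLo 0 <= 2 ^ r, ~~ exceeds n a (s' aLo 0) &
  (s' aHi 0 <= T -> exceeds n a (s' aHi 0))])) => //.
- rewrite s6 s7 leqnn ltnS aTle ltnn leqnn; split=> //.
    by apply: leq_trans (leq_subr _ _) TX.
  by apply/hasPn => j _; rewrite -leqNgt leq_mul.
- move=> r s1 fr [/andP[lo lohi] hiT hilo exlo exhi] /=; rewrite eqb0 negbK addn2 => gap.
  case: r hilo => [|r] hilo; first by move: hilo; rewrite expn0; lia.
  exists r => //; set mid := (s1 aLo 0 + s1 aHi 0) %/ 2.
  have [m1 m2 m3] : [/\ s1 aLo 0 < mid, mid < s1 aHi 0 & mid - s1 aLo 0 <= 2 ^ r].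
    by rewrite expnS in hilo; split; rewrite /mid; lia.
  have m4 : s1 aHi 0 - mid <= 2 ^ r by rewrite expnS in hilo; rewrite /mid; lia.
  apply: wp_seq; apply: wp_set => //=; rewrite -/mid; first by lia.
  apply: wp_seq.
  have [f0 f4 f5] : [/\ s1 aN = s aN, s1 aTau = s aTau & s1 aM = s aM] by split; rewrite fr.
  apply: (wp_conseq (wp_exceeds _ _ _)); rewrite /upd /= ?f0 ?f4 ?f5 //; first by lia.
  move=> s2 fr2 flag; rewrite -/a in flag.
  have [g6 g7 g8] : [/\ s2 aLo 0 = s1 aLo 0, s2 aHi 0 = s1 aHi 0 & s2 aMid 0 = mid] by split; rewrite fr2.
  apply: (wp_if L_gt0) => //=; rewrite flag.
    rewrite eqb0 negbK => ex; apply: wp_set => //=; rewrite g8; first by lia.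
    by rewrite /upd /= g6; split=> //; lia.
  move=> /eqP; rewrite eqb0 => ex; apply: wp_set => //=; rewrite g8; first by lia.
  by rewrite /upd /= g7; split=> //; lia.
- move=> r s1 fr [/andP[lo lohi] hiT hilo exlo exhi] /= /eqP; rewrite eqb0 addn2 => gap.
  split=> //; first by lia.
  by move=> c cb; apply: contra exlo; apply: exceeds_mono; lia.
Qed.

Definition breakpoints (tau : nat -> nat) M :=
  tau 0 = 0 /\ forall i, i < M -> [/\ tau i <= T, 0 < tau i.+1 <= T.+1 &
    forall j c, j < n -> c < tau i.+1 -> K * o j c <= K.+1 * o j (tau i)].

(** The sum of the ranks is the potential that bounds the number of breakpoints: each new one up to
    [T] increases it. *)
Lemma sum_rank_lt a b : b <= T -> a <= b -> exceeds n a b ->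
  \sum_(j < n) rank K (o j a) < \sum_(j < n) rank K (o j b).
Proof.
move=> bTle ab /hasP[j]; rewrite mem_iota add0n => /andP[_ jn] h.
rewrite (bigD1 (Ordinal jn)) //= [ltnRHS](bigD1 (Ordinal jn)) //= -addSn leq_add //.
  exact: rank_lt.
by apply: leq_sum => k _; rewrite rank_mono // o_mono.
Qed.

Lemma sum_rank_le a : a <= T -> \sum_(j < n) rank K (o j a) <= n * rank K F.
Proof.
move=> aTle; have -> : n * rank K F = \sum_(j < n) rank K F by rewrite sum_nat_const card_ord.
by apply: leq_sum => j _; rewrite rank_mono // oF.
Qed.

Lemma wp_breakpoints s : s aN 0 = n -> s aT 0 = T -> s aTau 0 = 0 -> s aM 0 = 0 ->
  wp (breakpoints_prog K) (fun s' => [/\ breakpoints (s' aTau) (s' aM 0),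
    0 < s' aM 0, s' aM 0 <= (n * rank K F).+1 & s' aTau (s' aM 0) = T.+1]) s.
Proof.
move=> s0 s3 s4 s5; pose R a := \sum_(j < n) rank K (o j a).
(* The potential [R] counts the breakpoints up to [T]; the successor in the bound on [m] accounts
   for the closing one, [T.+1]. *)
apply: (wp_while L_gt0 (Inv := fun r s' => let m := s' aM 0 in let a := s' aTau m in
  [/\ breakpoints (s' aTau) m, a <= T.+1, (a <= T -> m <= R a), m <= (n * rank K F).+1 &
      (a <= T -> (n * rank K F).+1 <= R a + r)]) rX) => //.
- by rewrite /= s5 s4; split=> //; rewrite leq_addl.
- move=> r s1 fr [bp aTle mR mle fuel] /=; rewrite eqb0 negbK => le_a.
  have [f0 f3] : s1 aN = s aN /\ s1 aT = s aT by split; rewrite fr.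
  rewrite f3 s3 in le_a; have Ra := sum_rank_le le_a; rewrite -/(R _) in Ra.
  have {mR} := mR le_a; have {fuel} := fuel le_a.
  set m := s1 aM 0 in bp aTle mle le_a Ra *; set a := s1 aTau m in bp aTle le_a Ra * => fuel mR.
  case: r fuel => [|r] fuel; first by lia.
  exists r => //.
  apply: wp_seq; apply: wp_set => //=; first by rewrite -/m -/a; lia.
  apply: wp_seq; apply: wp_set; rewrite //= /upd /= f3 s3 addn1 //.
  apply: wp_seq; apply: (wp_conseq (wp_bisect _ _ _ _)); rewrite //= ?f0 //.
  rewrite -/m -/a => s2 fr2 [/andP[ab bTle] nex ex]; set b := s2 aHi 0 in ab bTle nex ex.
  have [g4 g5] : s2 aTau = s1 aTau /\ s2 aM 0 = m by split; rewrite fr2.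
  apply: wp_seq; apply: wp_set; rewrite //= g5 addn1; first by lia.
  apply: wp_assign; rewrite //= /upd /= -/b; first by lia.
  rewrite g4 eqxx; split=> //.
  + case: bp => t0 bp; split=> //.
    move=> i; rewrite ltnS leq_eqVlt => /orP[/eqP->|im].
      rewrite eqxx (ltn_eqF (leqnn _)) -/a; split=> //; first by lia.
      by move=> j c jn /nex/exceedsNP; apply.
    by rewrite !ltn_eqF ?ltnS //; [apply: bp | lia].
  + by move=> bTle'; have := sum_rank_lt bTle' (ltnW ab) (ex bTle'); rewrite -!/(R _); lia.
  + by lia.
  + by move=> bTle'; have := sum_rank_lt bTle' (ltnW ab) (ex bTle'); rewrite -!/(R _); lia.
- move=> r s1 fr [bp aTle mR mle fuel] /= /eqP; rewrite eqb0 (fr aT) // s3 -ltnNge => ta.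
  split=> //; last by lia.
  by rewrite lt0n; apply/eqP => z; move: ta; rewrite z (proj1 bp).
Qed.

End Breakpoints.

(** * Approximation ratio and polynomial running time *)

Section Instance.
Variable I : instance.
Local Notation n := (njobs I).
Local Notation f := (cost_oracle I).

Definition proc (j : nat) : nat := init_store I aP j.

Lemma proc_ord (j : 'I_n) : proc j = ptime j.
Proof. by rewrite /proc /= valK. Qed.

Lemma cost_oracle_ord (j : 'I_n) : f j = @fcost I j.
Proof. by apply/funext => t; rewrite /cost_oracle valK. Qed.

Lemma cost_oracle_mono j : {homo f j : s t / s <= t}.
Proof. by move=> s t st; rewrite /cost_oracle; case: insub => // k; exact: fcost_nondecreasing. Qed.

Lemma horizonE : \sum_(j < n) proc j = horizon I.
Proof. by apply: eq_bigr => j _; rewrite proc_ord. Qed.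

(** Telescoping from [f_j(0) = 0]: the value at [t] is a sum of [t] increments. *)
Lemma cost_oracle_le j t : j < n -> t <= horizon I ->
  f j t <= horizon I * max_increment I.
Proof.
move=> jn tT; apply: (@leq_trans (t * max_increment I)); last by rewrite leq_mul.
rewrite -[j]/(val (Ordinal jn)) cost_oracle_ord; elim: t tT => [|t IH] tT.
  by rewrite fcost_0.
have {}IH := IH (ltnW tT).
have inc : fcost (Ordinal jn) t.+1 - fcost (Ordinal jn) t <= max_increment I.
  apply: leq_trans (leq_bigmax (Ordinal jn)).
  apply: (@leq_bigmax_seq _ _ xpredT (fun t => fcost (Ordinal jn) t - fcost (Ordinal jn) t.-1) t.+1) => //.
  by rewrite mem_index_iota ltnS.
by rewrite mulSn; lia.
Qed.

(** Remove the job of [A] that completes last: as processing times are positive, the others complete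
    by its start time, which replaces [B] in the induction. *)
Lemma feasible_sum_le (S : 'I_n -> nat) (A : pred 'I_n) B : feasible S ->
  (forall j, A j -> completion S j <= B) -> \sum_(j < n | A j) ptime j <= B.
Proof.
move=> fS; have [m] := ubnP #|A|; elim: m A B => // m IH A B; rewrite ltnS => cA CB.
case: (pickP A) => [j0 Aj0|no]; last by rewrite big_pred0.
case: (@arg_maxnP _ j0 A (completion S) Aj0) => j Aj maxj.
rewrite (bigD1 j) //=; apply: leq_trans (CB j Aj); rewrite addnC leq_add2r.
apply: IH.
  apply: leq_trans cA; apply: proper_card; apply/properP; split.
    by apply/subsetP => k /andP[].
  by exists j => //; rewrite unfold_in /= eqxx andbF.
move=> k /andP[Ak kj]; have := maxj k Ak; case: (fS k j kj) => // h.
by rewrite /completion in h *; have := ptime_gt0 k; lia.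
Qed.

(** * Passing between schedules and levels *)

Section Rounding.
Variables (K M : nat) (tau : nat -> nat) (S : 'I_n -> nat) (x l : nat -> nat).
Hypotheses (M_gt0 : 0 < M) (bp : breakpoints f K n (horizon I) tau M).
Hypothesis tauM : tau M = (horizon I).+1.
Let D i := horizon I - (tau i - 1).
Hypothesis xgood : good n M proc D (fun j i => f j (tau i)) l x.
Hypothesis SE : forall j : 'I_n, S j = \sum_(k < n | key n x k < key n x j) ptime k.

Lemma start_lt (i j : 'I_n) : key n x i < key n x j -> completion S i <= S j.
Proof.
move=> ij; rewrite /completion !SE [leqRHS](bigD1 i) //= addnC leq_add2l.
rewrite big_mkcond [leqRHS]big_mkcond leq_sum // => k _; case: ifP => // ki.
rewrite (ltn_trans ki ij) /=; case: eqP => // kiE.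
by rewrite kiE ltnn in ki.
Qed.

Lemma key_inj (i j : 'I_n) : key n x i = key n x j -> i = j.
Proof.
have n0 : 0 < n by exact: leq_ltn_trans (ltn_ord i).
move=> /(congr1 (modn^~ n)); rewrite /key /= !modnMDl !modn_small //.
exact: val_inj.
Qed.

Lemma schedule_feasible : feasible S.
Proof.
move=> i j ij; case: (ltngtP (key n x i) (key n x j)) => [/start_lt|/start_lt|/key_inj/eqP]; [by left|by right|by rewrite (negPf ij)].
Qed.

(** Jobs of higher level come after [j], and the covering condition at [(x j).+1] makes them long
    enough to leave at most [tau (x j).+1 - 1] for [j] and its predecessors. At the last level
    [tau M = T + 1] suffices. *)
Lemma schedule_completion (j : 'I_n) : completion S j < tau (x j).+1.
Proof.
have [cx lxM _ _] := xgood.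
have [_ /(_ _) bpx] := bp; have xM : x j < M by have /andP[] := lxM _ (ltn_ord j).
have [_ /andP[tau0 _] _] := bpx _ xM.
have Cle : completion S j + coverage n proc x (x j).+1 <= horizon I.
  rewrite /completion SE /coverage /horizon [in leqRHS](bigID (fun k : 'I_n => x j < x k)) /=.
  rewrite addnC leq_add //; first by apply: leq_sum => k _; rewrite proc_ord.
  rewrite [leqRHS](bigD1 j) ?ltnn //= addnC leq_add2l.
  rewrite big_mkcond [leqRHS]big_mkcond leq_sum // => k _; case: ifP => // kj.
  have -> : ~~ (x j < x k) && (k != j).
    apply/andP; split; last by apply: contraTneq kj => ->; rewrite ltnn.
    rewrite -leqNgt leqNgt; apply/negP => lt; move: kj; rewrite /key.
    by have := ltn_ord j; nia.
  by [].
have [xM'|] := ltnP (x j).+1 M.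
  by have /forallP/(_ (Ordinal xM')) /= := cx; rewrite /D; lia.
move=> Mx; have -> : (x j).+1 = M by lia.
by rewrite tauM; lia.
Qed.

(** In an optimal schedule let [y j] be the last [i] with [tau i <= C_j]; it exists as [tau 0 = 0].
    Jobs of level below [i] complete by [tau i - 1], so their total length is at most that, which is
    the covering condition. *)
Lemma opt_level_cost : exists y, [/\ covering n M proc D y,
  forall j, j < n -> y j < M & weight n (fun j i => f j (tau i)) y <= opt_cost I].
Proof.
have [tau0 bpM] := bp.
rewrite /opt_cost; case: ex_minnP => v /asboolP[S' fS' <-] _.
pose C j := if insub j is Some j' then completion S' j' else 0.
have CE (j : 'I_n) : C j = completion S' j by rewrite /C valK.
pose y j := \max_(i < M | tau i <= C j) i.
have yP j : y j < M /\ tau (y j) <= C j.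
  have [i ti yE] : {i : 'I_M | tau i <= C j & y j = i}.
    by apply: eq_bigmax_cond; apply/card_gt0P; exists (Ordinal M_gt0); rewrite unfold_in /= tau0.
  by rewrite yE.
exists y; split=> [|j _|]; last 1 first.
- apply: leq_sum => j _; rewrite -CE -cost_oracle_ord; apply: cost_oracle_mono.
  by case: (yP j).
- apply/forallP => i; rewrite /D leq_subLR /coverage /horizon.
  rewrite (bigID (fun j : 'I_n => i <= y j)) /= addnC leq_add //; last first.
    by apply: leq_sum => j _; rewrite proc_ord.
  apply: (feasible_sum_le fS') => j; rewrite -ltnNge => yi.
  rewrite -CE -ltnS; have lt : C j < tau i.
    rewrite ltnNge; apply/negP => ti; move: yi; rewrite ltnNge.
    by rewrite (@leq_bigmax_cond _ (fun i : 'I_M => tau i <= C j) (fun i : 'I_M => val i) i ti).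
  by lia.
- by case: (yP j).
Qed.

(** Rounding costs a factor [1 + 1/K] for each job, local ratio a factor 4. *)
Lemma schedule_cost_le : K * sched_cost S <= 4 * K.+1 * opt_cost I.
Proof.
have [_ lxM _ opt] := xgood.
have [y [cy yM wy]] := opt_level_cost.
apply: leq_trans (_ : K.+1 * weight n (fun j i => f j (tau i)) x <= _).
  rewrite /sched_cost /weight !big_distrr /=; apply: leq_sum => j _.
  have xM : x j < M by have /andP[] := lxM _ (ltn_ord j).
  have [_ _ h] := (proj2 bp) _ xM.
  by rewrite -cost_oracle_ord h // schedule_completion.
by rewrite [4 * _]mulnC -mulnA leq_mul // (leq_trans (opt _ cy yM)) // leq_mul.
Qed.

End Rounding.

Lemma input_size_gt1 : 1 < input_size I.
Proof. by rewrite /input_size /bits; lia. Qed.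

(** * Resource bounds in terms of the input size, and the complete run *)

Section Run.
Variable K : nat.
Hypothesis K_gt0 : 0 < K.
Let Z := input_size I.
(** From the inside out, the factors bound [rank K F], the number [M] of levels, and the [n * M]
    iterations of the longest loops. *)
Let X := Z * (Z * (Z * K + 1) + 1).
(** The residual weights are at most [F * T.+1 ^ (n * M)], where [F] and [T.+1] are at most [2 ^ Z]
    and [n * M <= X]. *)
Let L := Z * X.+1.
Let T := horizon I.
Let F := T * max_increment I.

Lemma lt_exp2_bits v : v < 2 ^ bits v.
Proof. exact: trunc_log_ltn. Qed.

Lemma le_nP : T <= n * max_ptime I.
Proof.
have -> : n * max_ptime I = \sum_(j < n) max_ptime I by rewrite sum_nat_const card_ord.
by apply: leq_sum => j _; exact: leq_bigmax.
Qed.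

Lemma T_lt : T < 2 ^ Z.
Proof.
apply: (@leq_trans (2 ^ (n + bits (max_ptime I)))); last by rewrite leq_exp2l // /Z /input_size leq_addr.
rewrite expnD; apply: leq_ltn_trans le_nP _.
have := lt_exp2_bits (max_ptime I); have := ltn_expl n (isT : 1 < 2); nia.
Qed.

(** [F] is at most [n * P * W], and the three summands of [input_size] bound the logarithms of the
    factors. *)
Lemma F_lt : F < 2 ^ Z.
Proof.
rewrite /F /Z /input_size !expnD; apply: leq_ltn_trans (leq_mul le_nP (leqnn _)) _.
have := lt_exp2_bits (max_ptime I); have := ltn_expl n (isT : 1 < 2).
have := lt_exp2_bits (max_increment I).
move: (2 ^ n) (2 ^ bits (max_ptime I)) (2 ^ bits (max_increment I)) => a b c.
move: (max_ptime I) (max_increment I) n => d e k h1 h2 h3.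
have : k * d < a * b by nia.
by move: (k * d) (a * b) => u v; nia.
Qed.

Lemma rank_F_le : rank K F <= Z * K + 1.
Proof.
rewrite /rank; apply: leq_trans (leq_trunc_log 2 (_ : _ <= 2 ^ (Z * K + 1))) _; last by rewrite trunc_expnK.
by rewrite addn1 expnS leq_mul // expnM leq_exp2r // ltnW // F_lt.
Qed.

Lemma M_le : (n * rank K F).+1 <= Z * (Z * K + 1) + 1.
Proof. by rewrite addn1 ltnS leq_mul ?rank_F_le // /Z /input_size -addnA leq_addr. Qed.

Lemma Z_le_X : Z <= X. Proof. by rewrite /X leq_pmulr // addn1. Qed.
Lemma n_le_Z : n <= Z. Proof. by rewrite /Z /input_size -addnA leq_addr. Qed.
Lemma X_le_L : X <= 2 ^ L.
Proof.
apply/ltnW/(leq_trans (ltn_expl X (isT : 1 < 2))).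
by rewrite leq_exp2l // /L; have := input_size_gt1; nia.
Qed.

Lemma Z_le_L k : k <= X.+1 -> 2 ^ (Z * k) <= 2 ^ L.
Proof. by move=> kX; rewrite leq_exp2l // leq_mul. Qed.

Lemma init_capped : capped L (init_store I).
Proof.
have nL : n <= 2 ^ L by apply: leq_trans n_le_Z (leq_trans Z_le_X X_le_L).
have TL : T <= 2 ^ L by apply: leq_trans (ltnW T_lt) _; rewrite -{1}[Z]muln1 Z_le_L.
case=> [|[|a]] [|i] //=; case: insubP => //= j _ _;
  by apply: leq_trans TL; rewrite /T /horizon (bigD1 j) //= leq_addr.
Qed.

Lemma wp_algorithm : wp (cost_oracle I) L X (algorithm K)
  (fun s => feasible (output I s) /\
     K * sched_cost (output I s) <= 4 * K.+1 * opt_cost I) (init_store I).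
Proof.
have L0 : 0 < L by rewrite /L muln_gt0; have := input_size_gt1; lia.
have nX : n <= X by apply: leq_trans n_le_Z Z_le_X.
have nL : n <= 2 ^ L by apply: leq_trans nX X_le_L.
have TL1 : T.+1 <= 2 ^ L by apply: leq_trans T_lt _; rewrite -{1}[Z]muln1 Z_le_L.
have TL : (\sum_(j < n) proc j).+1 <= 2 ^ L by rewrite horizonE.
have TX : T.+1 <= 2 ^ X by apply: leq_trans T_lt _; rewrite leq_exp2l // Z_le_X.
have FL : F <= 2 ^ L by apply: leq_trans (ltnW F_lt) _; rewrite -{1}[Z]muln1 Z_le_L.
have MX : (n * rank K F).+1 <= X by apply: leq_trans M_le _; rewrite /X leq_pmull //; have := input_size_gt1; lia.
have p_gt0 j : j < n -> 0 < proc j.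
  by move=> jn; rewrite -[j]/(val (Ordinal jn)) proc_ord ptime_gt0.
apply: wp_seq; apply: (wp_conseq (wp_total _ L0 nX nL TL _ _ _)) => // s1 fr1.
rewrite horizonE => s1T.
have a0 : s1 aN 0 = n by rewrite fr1.
have a1 : s1 aP = proc by rewrite fr1.
have a2 : s1 aOut = init_store I aOut by rewrite fr1.
have [a4 a5 a13 a21] : [/\ s1 aTau 0 = 0, s1 aM 0 = 0, s1 aLev = init_store I aLev & s1 aLen 0 = 0].
  by rewrite !fr1.
apply: wp_seq; apply: (wp_conseq (wp_breakpoints L0 K_gt0 nX nL TX TL1 FL cost_oracle_mono _ MX (leq_trans MX X_le_L) a0 s1T a4 a5)).
  exact: cost_oracle_le.
move=> s2 fr2 []; set M := s2 aM 0; set tau := s2 aTau => bp M0 Mle tauM.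
have {}MX : M <= X by apply: leq_trans MX.
have ML : M <= 2 ^ L by apply: leq_trans MX X_le_L.
have nMX : n * M <= X by rewrite /X leq_mul ?n_le_Z // (leq_trans Mle) // M_le.
have nML : n * M <= 2 ^ L by apply: leq_trans nMX X_le_L.
have FTL : F * (\sum_(j < n) proc j).+1 ^ (n * M) <= 2 ^ L.
  rewrite horizonE /L mulnS expnD leq_mul //; first exact: ltnW F_lt.
  case: (posnP (n * M)) => [->|nM0]; first by rewrite expn_gt0.
  apply: (@leq_trans ((2 ^ Z) ^ (n * M))); first by rewrite leq_exp2r // T_lt.
  by rewrite -expnM leq_exp2l // leq_mul.
have es2 : env n proc M tau s2 by split=> //; rewrite ?horizonE fr2.
apply: wp_seq; apply: (wp_conseq (wp_weights L0 nX nL TL MX ML nMX nML es2 M0 FL _)).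
  by move=> j i jn iM; apply: cost_oracle_le => //; have [] := (proj2 bp) _ iM.
move=> s3 fr3 [w3 F3].
have es3 : env n proc M tau s3 by apply: env_frame fr3 es2.
have l3 : s3 aLev = fun=> 0 by rewrite fr3 // fr2.
apply: wp_seq; apply: (wp_conseq (wp_raise _ L0 nX nL TL MX ML nMX nML p_gt0 FTL es3 _ _ M0 _ F3)).
- by move=> j _; rewrite l3.
- by move=> j jn; rewrite w3 // (proj1 bp); rewrite -[j]/(val (Ordinal jn)) cost_oracle_ord fcost_0.
- by rewrite fr3 // fr2.
move=> s4 fr4 [g4 k4].
have es4 : env n proc M tau s4 by apply: env_frame fr4 es3.
apply: wp_seq; apply: (wp_conseq (wp_prune _ L0 nX nL TL MX ML es4 (leq_trans k4 nMX))) => s5 fr5 x5.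
have es5 : env n proc M tau s5 by apply: env_frame fr5 es4.
rewrite -x5 in g4.
apply: (wp_conseq (wp_schedule _ L0 nX nL TL es5 _)) => [j|s6 fr6 S6].
  by rewrite fr5 // fr4 // fr3 // fr2 // a2.
have SE (j : 'I_n) : output I s6 j = \sum_(k < n | key n (s5 aLev) k < key n (s5 aLev) j) ptime k.
  by rewrite /output S6 //; apply: eq_bigr => k _; rewrite proc_ord.
(* The guarantee for the stored table carries over to the weights [f_j(tau i)], since both agree at
   levels below [M]. *)
have g : good n M proc (fun i => horizon I - (tau i - 1)) (fun j i => f j (tau i)) (s3 aLev) (s5 aLev).
  have [c lx mn opt] := g4; rewrite horizonE in c mn opt; split=> // y cy yM.
  have wE z : (forall j, j < n -> z j < M) -> weight n (table M s3) z = weight n (fun j i => f j (tau i)) z.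
    by move=> zM; apply: eq_bigr => j _; rewrite w3 ?zM.
  rewrite -!wE //; first exact: opt.
  by move=> j jn; have /andP[] := lx _ jn.
split; first exact: schedule_feasible SE.
exact: (schedule_cost_le M0 bp tauM g SE).
Qed.

Lemma algorithm_run : exists t s,
  [/\ exec (cost_oracle I) (algorithm K) (init_store I) t s,
      t <= X.+1 ^ 2 * cost X (algorithm K), feasible (output I s) &
      K * sched_cost (output I s) <= 4 * K.+1 * opt_cost I].
Proof.
have [t [s [e le_t _ [fs cs]]]] := wp_algorithm init_capped.
exists t, s; split=> //; apply: leq_trans le_t _; rewrite leq_mul // /L.
by have := Z_le_X; rewrite -mulnn; nia.
Qed.

End Run.
End Instance.

Lemma algorithm_polynomial K : 0 < K -> polynomial_time (algorithm K).
Proof.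
move=> K0; have [A [d cA]] := cost_polynomial (algorithm K).
(* With [Z] the input size, [X.+1 <= (K + 3) * Z ^ 3]; the exponent [d.+2] combines the degree of
   [cost] with the factor [X.+1 ^ 2]. *)
exists (A * (K + 3) ^ d.+2), (3 * d.+2) => I.
have [t [s [e]]] := algorithm_run I K0; set X := input_size I * _ => le_t _ _.
exists t, s; split=> //; apply: leq_trans le_t _.
apply: leq_trans (leq_mul (leqnn _) (cA X)) _.
rewrite mulnCA -expnD add2n -mulnA leq_mul // expnM -expnMn leq_exp2r //.
rewrite /X; have := input_size_gt1 I; move: (input_size I) => Z Z1.
have Z2 : Z <= Z * Z by rewrite leq_pmulr // ltnW.
have Z3 : Z * Z <= Z * (Z * Z) by rewrite leq_pmull // ltnW.
by rewrite !expnS expn0; nia.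
Qed.

Local Open Scope ring_scope.

Theorem theorem11 (R : realType) (eps : R) (heps : 0 < eps) :
  exists c : cmd, approximation_algorithm (4 + eps) c.
Proof.
(* This choice of [K] makes [4 * (1 + 1/K)] at most [4 + eps]. *)
have [K K_gt0 Kr] : exists2 K, (0 < K)%N & 4 / eps <= K%:R.
  exists (Num.bound (4 / eps)).+1 => //.
  apply: le_trans (_ : (Num.bound (4 / eps))%:R <= _); last by rewrite ler_nat leqnSn.
  by apply/ltW/archi_boundP; rewrite divr_ge0 ?ltW.
exists (algorithm K); split; first exact: algorithm_polynomial.
move=> I; have [t [s [e _ fs cs]]] := algorithm_run I K_gt0.
exists t, s; split=> //; split=> //.
have K0 : 0 < K%:R :> R by rewrite ltr0n.
rewrite -(ler_pM2l K0) mulrA -natrM; apply: le_trans (_ : (4 * K.+1 * opt_cost I)%N%:R <= _).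
  by rewrite ler_nat.
rewrite natrM ler_wpM2r // natrM -[K.+1%:R]natr1 mulrDr mulr1 (mulrDr K%:R) [4 * _]mulrC lerD2l.
by rewrite -ler_pdivrMr.
Qed.
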